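(* Let $K$ be a CM-field whose maximal real subfield $F$ has class number one, and let $N$ be a positive integer. Then the map $$\phi_{K,N}:\ \mathcal{C}_F(N,d_K)\to\mathcal{C}(N\mathcal{O}_K),\qquad [Q]\mapsto[[\omega_Q,1]_F],$$ is a well-defined bijection. Consequently $\mathcal{C}_F(N,d_K)$ can be regarded as a group isomorphic to the ray class group $\mathcal{C}(N\mathcal{O}_K)$ via this bijection (i.e. it can be endowed with a group structure for which $\phi_{K,N}$ is a group isomorphism).
   Context: All number fields are subfields of $\mathbb{C}$; $\mathbb{H}$ is the complex upper half-plane and $\overline{\,\cdot\,}$ is complex conjugation. $K$ is a CM-field, i.e. a totally imaginary quadratic extension of a totally real number field $F$. $F$ is assumed to have class number one, so $\mathcal{O}_F$ is a PID and gcd's in $\mathcal{O}_F$ are taken up to units. For $x\in F$, $x>0$ and $x<0$ refer to the given (identity) embedding $F\subset\mathbb{R}$. For $\nu_1,\nu_2\in K$, $[\nu_1,\nu_2]_F=\mathcal{O}_F\nu_1+\mathcal{O}_F\nu_2$. In this setting there is an element $\omega_K\in K\cap\mathbb{H}$ with $\mathcal{O}_K=[\omega_K,1]_F$; fix one. If $x^2+b_Kx+c_K\in\mathcal{O}_F[x]$ is the minimal polynomial of $\omega_K$ over $F$, put $d_K=b_K^2-4c_K$ (totally negative). Forms: $\mathcal{Q}_F(N,d_K)$ is the set of $Q=ax^2+bxy+cy^2\in\mathcal{O}_F[x,y]$ with $\gcd(a,b,c)=1$, $a>0$, $b^2-4ac=d_K$ and $\gcd(a,N)=1$. For such $Q$,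 $\omega_Q$ is the zero of $Q(x,1)$ in $\mathbb{H}$. The group $$\Gamma_{F,1}(N)=\left\{\gamma=\begin{bmatrix} c_1 & c_2 \\ c_3 & c_4 \end{bmatrix}\in\mathrm{GL}_2(\mathcal{O}_F)\ \Big|\ \det(\gamma)>0,\ c_3\equiv0,\ c_4\equiv\zeta\ (\mathrm{mod}\ N\mathcal{O}_F)\text{ for some }\zeta\in\mathcal{O}_F^\times\right\}$$ acts on $\mathcal{Q}_F(N,d_K)$ by $Q^\gamma\left(\begin{bmatrix} x \\ y \end{bmatrix}\right)=\frac{1}{\det(\gamma)}Q\left(\gamma\begin{bmatrix} x \\ y \end{bmatrix}\right)$. Two forms are equivalent if $Q'=Q^\gamma$ for some $\gamma\in\Gamma_{F,1}(N)$; $\mathcal{C}_F(N,d_K)$ is the set of equivalence classes $[Q]$. Ray class group: $I_K(N\mathcal{O}_K)$ is the group of fractional ideals of $K$ relatively prime to $N\mathcal{O}_K$; $P_{K,1}(N\mathcal{O}_K)=\{\nu\mathcal{O}_K\mid\nu\in K^\times,\ \nu\equiv^*1\ (\mathrm{mod}\ N\mathcal{O}_K)\}$, where $\nu\equiv^*\lambda\ (\mathrm{mod}\ N\mathcal{O}_K)$ means $v_\mathfrak{p}(\nu/\lambda-1)\ge v_\mathfrak{p}(N\mathcal{O}_K)$ for every prime ideal $\mathfrak{p}$ dividing $N\mathcal{O}_K$; and $\mathcal{C}(N\mathcal{O}_K)=I_K(N\mathcal{O}_K)/P_{K,1}(N\mathcal{O}_K)$. *)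

(* Defs.v *)
From HB Require Import structures.
From mathcomp Require Import all_boot all_order all_algebra all_field.
From mathcomp Require Import all_classical all_reals.
From mathcomp Require Import complex.
From mathcomp Require Import ring.

Set Implicit Arguments.
Unset Strict Implicit.
Unset Printing Implicit Defensive.

Import Order.TTheory GRing.Theory Num.Theory.

Local Open Scope classical_set_scope.
Local Open Scope ring_scope.

(** ** Rings of integers and their ideals *)

Section Integers.
Variable L : fieldType.
Implicit Types (x y : L) (I J P : set L).

Definition ringOfIntegers : set L :=
  [set x | integralOver (intr : int -> L) x].

Local Notation O := ringOfIntegers.

Definition unitO x : Prop := [/\ x != 0, O x & O x^-1].

Definition dvdO x y : Prop := exists2 q, O q & y = q * x.

(* Equality of a gcd to 1 is meant up to units. *)
Definition gcd_one (s : seq L) : Prop :=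
  forall x, O x -> (forall y, y \in s -> dvdO x y) -> unitO x.

Definition fracIdeal I : Prop :=
  [/\ (exists2 x, I x & x != 0),
      (forall x y, I x -> I y -> I (x + y)),
      (forall a x, O a -> I x -> I (a * x))
    & (exists d, [/\ O d, d != 0 & forall x, I x -> O (d * x)])].

Definition intIdeal I : Prop := fracIdeal I /\ I `<=` O.

Definition principal x : set L := [set a * x | a in O].

Definition classNumberOne : Prop :=
  forall I, fracIdeal I -> exists2 x, x != 0 & I = principal x.

Definition mulIdeal I J : set L :=
  [set x | exists2 s : seq (L * L),
     (forall p, p \in s -> I p.1 /\ J p.2) & x = \sum_(p <- s) p.1 * p.2].

Definition expIdeal I (n : nat) : set L := iter n (mulIdeal I) O.

Definition dvdIdeal I J : Prop := exists2 I', intIdeal I' & J = mulIdeal I I'.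

(* As [intIdeal] requires an ideal to be nonzero, so does [primeIdeal]. *)
Definition primeIdeal P : Prop :=
  [/\ intIdeal P, ~ P 1
    & forall x y, O x -> O y -> P (x * y) -> P x \/ P y].

(* The exponent of [P] in the factorization of the fractional ideal [I]: it is
   [m - n] when [I = P^(m - n) A B^-1] with [A] and [B] prime to [P].  The value
   is meaningful only for [I] a fractional ideal and [P] a prime ideal of the
   ring of integers of a number field. *)
Definition valuation P I : int :=
  xget 0 [set k : int | exists m n A B,
    [/\ k = m%:Z - n%:Z,
        intIdeal A /\ ~ dvdIdeal P A,
        intIdeal B /\ ~ dvdIdeal P B
      & mulIdeal (mulIdeal (expIdeal P n) B) I = mulIdeal (expIdeal P m) A]].

(** ** Ray classes modulo an integer *)

Variable N : nat.

Definition primeDivisor P : Prop :=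
  primeIdeal P /\ dvdIdeal P (principal N%:R).

Definition idealsPrimeTo : set (set L) :=
  [set I | fracIdeal I /\ forall P, primeDivisor P -> valuation P I = 0].

(* The first alternative accounts for the valuation of 0 being infinite. *)
Definition congStar x y : Prop :=
  forall P, primeDivisor P ->
    x / y - 1 = 0 \/
    valuation P (principal N%:R) <= valuation P (principal (x / y - 1)).

Definition rayPrincipal : set (set L) :=
  [set principal x | x in [set x | x != 0 /\ congStar x 1]].

Definition rayClass I : set (set L) := [set mulIdeal I J | J in rayPrincipal].

Definition rayClassGroup : set (set (set L)) :=
  [set rayClass I | I in idealsPrimeTo].

(* The product of two cosets. *)
Definition mulRayClass (X Y : set (set L)) : set (set L) :=
  [set mulIdeal I J | I in X & J in Y].

End Integers.

Arguments ringOfIntegers : clear implicits.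
Arguments rayClassGroup : clear implicits.

(** ** CM-fields *)

Definition totallyReal (R : realType) (F : fieldType) : Prop :=
  forall (s : {rmorphism F -> R[i]}) x, s x \is Num.real.

Definition totallyImaginary (R : realType) (K : fieldType) : Prop :=
  forall s : {rmorphism K -> R[i]}, exists x, s x \isn't Num.real.

Definition isCM (R : realType) (F : fieldExtType rat) (K : fieldExtType F) :
    Prop :=
  [/\ totallyReal R F, totallyImaginary R K & \dim {:K} = 2%N].

(** ** Binary quadratic forms *)

Record bqForm (F : Type) := Form { fa : F; fb : F; fc : F }.

Section Forms.
Variable F : fieldType.
Implicit Types (Q : bqForm F) (g : 'M[F]_2) (v : 'cV[F]_2).

Definition evalForm Q v : F :=
  fa Q * v 0 0 ^+ 2 + fb Q * v 0 0 * v 1 0 + fc Q * v 1 0 ^+ 2.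

Definition discForm Q : F := fb Q ^+ 2 - 4%:R * fa Q * fc Q.

(* See [evalForm_act] for the intrinsic description. *)
Definition actForm Q g : bqForm F :=
  Form ((\det g)^-1 *
          (fa Q * g 0 0 ^+ 2 + fb Q * g 0 0 * g 1 0 + fc Q * g 1 0 ^+ 2))
       ((\det g)^-1 *
          (2%:R * fa Q * g 0 0 * g 0 1
           + fb Q * (g 0 0 * g 1 1 + g 0 1 * g 1 0)
           + 2%:R * fc Q * g 1 0 * g 1 1))
       ((\det g)^-1 *
          (fa Q * g 0 1 ^+ 2 + fb Q * g 0 1 * g 1 1 + fc Q * g 1 1 ^+ 2)).

Lemma evalForm_act Q g v :
  evalForm (actForm Q g) v = (\det g)^-1 * evalForm Q (g *m v).
Proof.
rewrite /evalForm /= !mxE !big_ord_recl !big_ord0 /=.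
have -> : lift ord0 ord0 = 1 :> 'I_2 by apply/val_inj.
by ring.
Qed.

End Forms.

(* A number field inside the complex numbers is a finite extension with an
   embedding [iota]; [F] is seen in the reals through [iota] as well. *)
Section FormClasses.
Variables (R : realType) (F : fieldExtType rat) (K : fieldExtType F).
Variable iota : {rmorphism K -> R[i]}.

Definition upperHalf : set K := [set z | 0 < complex.Im (iota z)].

Definition positive (x : F) : Prop := 0 < iota x%:A.

Definition lattice (z1 z2 : K) : set K :=
  [set z | exists a b, [/\ ringOfIntegers F a, ringOfIntegers F b
                         & z = a *: z1 + b *: z2]].

Variables (N : nat) (d : F).

Definition forms : set (bqForm F) :=
  [set Q | [/\ [/\ ringOfIntegers F (fa Q), ringOfIntegers F (fb Q)
                 & ringOfIntegers F (fc Q)],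
               gcd_one [:: fa Q; fb Q; fc Q],
               positive (fa Q),
               discForm Q = d
             & gcd_one [:: fa Q; N%:R]]].

Definition Gamma1 : set 'M[F]_2 :=
  [set g : 'M[F]_2 | [/\ (forall i j, ringOfIntegers F (g i j)) /\ unitO (\det g),
               positive (\det g),
               dvdO N%:R (g 1 0)
             & exists2 u : F, unitO u & dvdO N%:R (g 1 1 - u)]].

Definition formClass (Q : bqForm F) : set (bqForm F) :=
  [set actForm Q g | g in Gamma1].

Definition formClasses : set (set (bqForm F)) :=
  [set formClass Q | Q in forms].

(* For [Q] in [forms] and [d] the discriminant attached to a generator of the
   ring of integers of [K], this root exists in [K] and is unique. *)
Definition rootForm (Q : bqForm F) : K :=
  xget 0 [set z | upperHalf z
                  /\ fa Q *: z ^+ 2 + fb Q *: z + (fc Q)%:A = 0].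

End FormClasses.

(** ** Groups carried by sets *)

Definition isGroupOn (T : Type) (A : set T) (op : T -> T -> T) : Prop :=
  [/\ (forall x y, A x -> A y -> A (op x y)),
      (forall x y z, A x -> A y -> A z -> op x (op y z) = op (op x y) z)
    & exists e, [/\ A e, (forall x, A x -> op e x = x /\ op x e = x)
        & forall x, A x -> exists y, [/\ A y, op y x = e & op x y = e]]].

Definition isGroupIsoOn (T U : Type) (A : set T) (opA : T -> T -> T)
    (B : set U) (opB : U -> U -> U) (f : T -> U) : Prop :=
  [/\ isGroupOn A opA, isGroupOn B opB, set_bij A B f
    & forall x y, A x -> A y -> f (opA x y) = opB (f x) (f y)].

(* Main.v *)
Require Import Defs.
From mathcomp Require Import all_boot all_order all_algebra all_field.
From mathcomp Require Import all_classical all_reals.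
From mathcomp Require Import complex.
From mathcomp Require Import ring.

(* Every form Q = a x^2 + b x y + c y^2 of discriminant d_K with a > 0 has
   omega_Q = (omega_K - t) / a with t in O_F and a | t^2 + b_K t + c_K, and every
   fractional ideal of K is a multiple of such a lattice [omega_K - t, a], whose
   product with its conjugate is (a); hence ideals of K are invertible.

   Modulo N the valuations reduce to congruences: I is prime to N iff some
   beta I is integral and contains an alpha, with alpha = beta = 1 (mod N), and
   nu =* 1 iff nu is a quotient of two integers congruent to 1.

   For surjectivity, take I integral containing some alpha = 1 (mod N).  As O_F
   has stable range one modulo N, alpha can be changed modulo N I into a
   primitive vector nu of the O_F-lattice I, and I = nu [z, 1] where z is a root
   of a form whose leading coefficient is prime to N because nu = 1 (mod N).
   For injectivity, [z, 1] nu = [z', 1] gives a matrix whose second row is read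
   off from nu, and the condition nu =* 1 says that this row is (0, 1) modulo N. *)

(** The discriminant d_K belongs to the full ring O_K; this forces a, b_K + 2 t and (t^2 + b_K t +
    c_K) / a to be coprime, and a Bezout relation between them puts a itself into the product of a
    lattice with its conjugate. Divisibility and valuations of ideals are then derived from
    invertibility alone.

    Positivity concerns one embedding only: F is real there, so x omega_K + y lies in the upper
    half-plane iff x > 0. Hence d_K < 0 makes every form definite, and det > 0 is the condition
    under which a matrix preserves the half-plane.

    The unit zeta is the gap between ideals and generators: a matrix whose second row is (0, zeta)
    modulo N scales a lattice by some nu close to zeta, and nu O_K does not change when nu is
    divided by zeta.

    For alpha = 1 (mod N) the gcd of its coordinates in a basis of I is only prime to N, whereas a
    vector extends to a basis only if that gcd is 1. This is why a stable range argument is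
    needed. *)

Set Implicit Arguments.
Unset Strict Implicit.
Unset Printing Implicit Defensive.

Import Order.TTheory GRing.Theory Num.Theory.

Local Open Scope classical_set_scope.
Local Open Scope ring_scope.

(** * Fractional ideals *)

Section Ideals.

Variable L : fieldType.
Implicit Types (x y z : L) (I J H P : set L).

Local Notation O := (ringOfIntegers L).

Lemma integers0 : O 0. Proof. exact: integral0. Qed.
Lemma integers1 : O 1. Proof. exact: integral1. Qed.
Lemma integersN x : O x -> O (- x). Proof. exact: integral_opp. Qed.
Lemma integersD x y : O x -> O y -> O (x + y). Proof. exact: integral_add. Qed.
Lemma integersB x y : O x -> O y -> O (x - y). Proof. exact: integral_sub. Qed.
Lemma integersM x y : O x -> O y -> O (x * y). Proof. exact: integral_mul. Qed.
Lemma integers_nat n : O n%:R. Proof. exact: integral_nat. Qed.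

Hint Resolve integers0 integers1 : core.

Lemma integersX x n : O x -> O (x ^+ n).
Proof.
by move=> Ox; elim: n => [|n IH]; rewrite ?expr0 // exprS; apply: integersM.
Qed.

Lemma fracIdeal0 I : fracIdeal I -> I 0.
Proof. by case=> [[x Ix _] _ IM _]; rewrite -(mul0r x); apply: IM. Qed.

Lemma fracIdealD I x y : fracIdeal I -> I x -> I y -> I (x + y).
Proof. by case=> _ ID _ _; apply: ID. Qed.

Lemma fracIdealM I a x : fracIdeal I -> O a -> I x -> I (a * x).
Proof. by case=> _ _ IM _; apply: IM. Qed.

Lemma fracIdealN I x : fracIdeal I -> I x -> I (- x).
Proof.
by move=> fI Ix; rewrite -mulN1r; apply: fracIdealM => //; exact: integersN.
Qed.

Lemma fracIdealB I x y : fracIdeal I -> I x -> I y -> I (x - y).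
Proof. by move=> fI Ix Iy; apply: fracIdealD => //; apply: fracIdealN. Qed.

Lemma mem_mulIdeal I J x y : I x -> J y -> mulIdeal I J (x * y).
Proof.
move=> Ix Jy; exists [:: (x, y)]; last by rewrite big_seq1.
by move=> p; rewrite inE => /eqP ->.
Qed.

Lemma mulIdeal0 I J : mulIdeal I J 0.
Proof. by exists [::] => [p|]; rewrite ?inE ?big_nil. Qed.

Lemma mulIdealD I J x y :
  mulIdeal I J x -> mulIdeal I J y -> mulIdeal I J (x + y).
Proof.
move=> [s sP ->] [t tP ->]; exists (s ++ t); last by rewrite big_cat.
by move=> p; rewrite mem_cat => /orP[/sP|/tP].
Qed.

(** [H] need only be an additive submonoid, so it may be a preimage under multiplication by a fixed
    element; nested products are treated that way. *)
Lemma mulIdeal_min I J H : H 0 -> (forall x y, H x -> H y -> H (x + y)) ->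
  (forall x y, I x -> J y -> H (x * y)) -> mulIdeal I J `<=` H.
Proof.
move=> H0 HD HM _ [s sP ->]; elim: s sP => [|p s IH] sP; rewrite ?big_nil //.
rewrite big_cons; apply: HD; last by apply: IH => q qs; apply: sP; rewrite inE qs orbT.
by have [Ip Jp] := sP p (mem_head _ _); apply: HM.
Qed.

Lemma mulIdealC I J : mulIdeal I J = mulIdeal J I.
Proof.
have sub (A B : set L) : mulIdeal A B `<=` mulIdeal B A.
  apply: mulIdeal_min; [exact: mulIdeal0 | exact: mulIdealD |].
  by move=> x y Ax By; rewrite mulrC; apply: mem_mulIdeal.
by apply/seteqP; split; apply: sub.
Qed.

Lemma mulIdealA I J H : mulIdeal I (mulIdeal J H) = mulIdeal (mulIdeal I J) H.
Proof.
have sub (A B C : set L) : mulIdeal A (mulIdeal B C) `<=` mulIdeal (mulIdeal A B) C.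
  apply: mulIdeal_min; [exact: mulIdeal0 | exact: mulIdealD |].
  move=> x y Ax; apply: (@mulIdeal_min _ _ [set y | mulIdeal (mulIdeal A B) C (x * y)]).
  - by rewrite /= mulr0; apply: mulIdeal0.
  - by move=> u v /= ? ?; rewrite mulrDr; apply: mulIdealD.
  - move=> u v Bu Cv /=; rewrite mulrA.
    by apply: mem_mulIdeal => //; apply: mem_mulIdeal.
apply/seteqP; split; first exact: sub.
rewrite [mulIdeal (mulIdeal I J) H]mulIdealC [mulIdeal I J]mulIdealC.
by rewrite [mulIdeal I _]mulIdealC [mulIdeal J H]mulIdealC; apply: sub.
Qed.

Lemma mulIdealAC I J H : mulIdeal (mulIdeal I J) H = mulIdeal (mulIdeal I H) J.
Proof. by rewrite -!mulIdealA [mulIdeal J H]mulIdealC. Qed.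

Lemma mulIdealACA I J H P :
  mulIdeal (mulIdeal I J) (mulIdeal H P) = mulIdeal (mulIdeal I H) (mulIdeal J P).
Proof. by rewrite !mulIdealA [mulIdeal (mulIdeal I J) H]mulIdealAC. Qed.

Lemma mulIdealS I I' J : I `<=` I' -> mulIdeal I J `<=` mulIdeal I' J.
Proof.
move=> sub; apply: mulIdeal_min; [exact: mulIdeal0 | exact: mulIdealD |].
by move=> x y /sub ? ?; apply: mem_mulIdeal.
Qed.

Lemma mul1Ideal I : fracIdeal I -> mulIdeal O I = I.
Proof.
move=> fI; apply/seteqP; split.
  apply: mulIdeal_min; first exact: fracIdeal0.
    by move=> x y; apply: fracIdealD.
  by move=> x y; apply: fracIdealM.
by move=> x Ix; rewrite -[x]mul1r; apply: mem_mulIdeal.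
Qed.

Lemma mulIdeal1 I : fracIdeal I -> mulIdeal I O = I.
Proof. by rewrite mulIdealC; apply: mul1Ideal. Qed.

Lemma fracIdealO : fracIdeal O.
Proof.
split; [by exists 1; rewrite ?oner_eq0 | exact: integersD | exact: integersM |].
by exists 1; rewrite oner_eq0; split=> // x; rewrite mul1r.
Qed.

Lemma intIdealO : intIdeal O.
Proof. by split=> //; apply: fracIdealO. Qed.

Lemma fracIdeal_mul I J : fracIdeal I -> fracIdeal J -> fracIdeal (mulIdeal I J).
Proof.
move=> fI fJ; have [[x Ix x0] _ _ [d [Od d0 dI]]] := fI.
have [[y Jy y0] _ _ [e [Oe e0 eJ]]] := fJ; split.
- by exists (x * y); [apply: mem_mulIdeal | rewrite mulf_neq0].
- exact: mulIdealD.
- move=> a z Oa; apply: (@mulIdeal_min _ _ [set z | mulIdeal I J (a * z)]).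
  + by rewrite /= mulr0; apply: mulIdeal0.
  + by move=> u v /= ? ?; rewrite mulrDr; apply: mulIdealD.
  + by move=> u v Iu Jv /=; rewrite mulrA; apply: mem_mulIdeal => //; apply: fracIdealM.
- exists (d * e); split; [exact: integersM | by rewrite mulf_neq0 |].
  apply: (@mulIdeal_min _ _ [set z | O (d * e * z)]).
  + by rewrite /= mulr0.
  + by move=> u v /= ? ?; rewrite mulrDr; apply: integersD.
  + by move=> u v Iu Jv /=; rewrite mulrACA; apply: integersM; [apply: dI | apply: eJ].
Qed.

Lemma intIdeal_mul I J : intIdeal I -> intIdeal J -> intIdeal (mulIdeal I J).
Proof.
move=> [fI IO] [fJ JO]; split; first exact: fracIdeal_mul.
apply: mulIdeal_min => // [|x y /IO ? /JO ?]; [exact: integersD | exact: integersM].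
Qed.

Lemma fracIdeal_exp I n : fracIdeal I -> fracIdeal (expIdeal I n).
Proof.
by move=> fI; elim: n => [|n IH]; [apply: fracIdealO | apply: fracIdeal_mul].
Qed.

Lemma intIdeal_exp I n : intIdeal I -> intIdeal (expIdeal I n).
Proof.
by move=> iI; elim: n => [|n IH]; [apply: intIdealO | apply: intIdeal_mul].
Qed.

Lemma expIdealD I m n : fracIdeal I ->
  expIdeal I (m + n) = mulIdeal (expIdeal I m) (expIdeal I n).
Proof.
move=> fI; elim: m => [|m IH]; first by rewrite mul1Ideal //; apply: fracIdeal_exp.
by rewrite addSn /expIdeal /= -/(expIdeal I _) IH mulIdealA.
Qed.

Lemma principal1 : principal 1 = O.
Proof.
apply/seteqP; split; first by move=> _ [a Oa <-]; rewrite mulr1.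
by move=> a Oa; exists a; rewrite ?mulr1.
Qed.

Lemma mem_principal x : principal x x.
Proof. by exists 1; rewrite ?mul1r. Qed.

Lemma fracIdeal_principal x (d : L) : x != 0 -> O d -> d != 0 -> O (d * x) ->
  fracIdeal (principal x).
Proof.
move=> x0 Od d0 Odx; split; first by exists x; [apply: mem_principal|].
- by move=> _ _ [a Oa <-] [b Ob <-]; exists (a + b); rewrite ?mulrDl //;
  apply: integersD.
- by move=> a _ Oa [b Ob <-]; exists (a * b); rewrite ?mulrA //; apply: integersM.
- by exists d; split=> // _ [a Oa <-]; rewrite mulrCA; apply: integersM.
Qed.

Lemma intIdeal_principal x : O x -> x != 0 -> intIdeal (principal x).
Proof.
move=> Ox x0; split; last by move=> _ [a Oa <-]; apply: integersM.
by apply: (fracIdeal_principal x0 integers1); rewrite ?oner_eq0 ?mul1r.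
Qed.

Lemma mem_mul_principal x I : fracIdeal I ->
  mulIdeal (principal x) I = [set x * y | y in I].
Proof.
move=> fI; apply/seteqP; split; last first.
  by move=> _ [y Iy <-]; apply: mem_mulIdeal => //; apply: mem_principal.
apply: mulIdeal_min.
- by exists 0; rewrite ?mulr0 //; apply: fracIdeal0.
- by move=> _ _ [u Iu <-] [v Iv <-]; exists (u + v); rewrite ?mulrDr //;
  apply: fracIdealD.
- move=> _ v [a Oa <-] Iv; exists (a * v); first exact: fracIdealM.
  by rewrite mulrA [x * a]mulrC.
Qed.

Lemma principalM x y : mulIdeal (principal x) (principal y) = principal (x * y).
Proof.
apply/seteqP; split; last first.
  move=> _ [a Oa <-]; rewrite mulrA; apply: mem_mulIdeal; first by exists a.
  exact: mem_principal.
apply: mulIdeal_min.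
- by exists 0; rewrite ?mul0r.
- by move=> _ _ [u Iu <-] [v Iv <-]; exists (u + v); rewrite ?mulrDl //;
  apply: integersD.
- move=> _ _ [a Oa <-] [b Ob <-]; exists (a * b); first exact: integersM.
  by rewrite mulrACA.
Qed.

Lemma dvdIdeal_sub P I : fracIdeal P -> dvdIdeal P I -> I `<=` P.
Proof.
move=> fP [J [_ JO] ->]; rewrite mulIdealC -[X in _ `<=` X](mul1Ideal fP).
exact: mulIdealS.
Qed.

End Ideals.

#[global] Hint Resolve integers0 integers1 : core.

(** * Valuations *)

(** The one property of Dedekind domains on which the theory of valuations rests; for [K] it comes
    from conjugate lattices. *)
Definition invertibleIdeals (L : fieldType) : Prop :=
  forall I : set L, fracIdeal I ->
  exists2 J, fracIdeal J & mulIdeal I J = ringOfIntegers L.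

Section Valuations.

Variable L : fieldType.
Implicit Types (x y z : L) (I J A B C P : set L).

Local Notation O := (ringOfIntegers L).

Hypothesis invertible : invertibleIdeals L.

Lemma mulIdeal_subI A I J : fracIdeal A -> fracIdeal I -> fracIdeal J ->
  mulIdeal A I `<=` mulIdeal A J -> I `<=` J.
Proof.
move=> fA fI fJ sub; have [B fB AB] := invertible fA.
rewrite -(mul1Ideal fI) -(mul1Ideal fJ) -AB [mulIdeal A B]mulIdealC -!mulIdealA.
by rewrite mulIdealC [mulIdeal B _]mulIdealC; apply: mulIdealS.
Qed.

Lemma mulIdealI A I J : fracIdeal A -> fracIdeal I -> fracIdeal J ->
  mulIdeal A I = mulIdeal A J -> I = J.
Proof.
by move=> fA fI fJ e; apply/seteqP; split; apply: (mulIdeal_subI fA) => //; rewrite e.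
Qed.

(** To contain is to divide: the cofactor [I] P^-1 is integral because it lies in P P^-1 = [O]. *)
Lemma dvdIdealE P I : fracIdeal P -> fracIdeal I -> dvdIdeal P I <-> I `<=` P.
Proof.
move=> fP fI; split=> [|sub]; first exact: dvdIdeal_sub.
have [J fJ PJ] := invertible fP; exists (mulIdeal I J); last first.
  by rewrite mulIdealC -mulIdealA [mulIdeal J P]mulIdealC PJ mulIdeal1.
by split; [exact: fracIdeal_mul | rewrite -PJ; apply: mulIdealS].
Qed.

Lemma prime_dvd_mul P A B : primeIdeal P -> intIdeal A -> intIdeal B ->
  dvdIdeal P (mulIdeal A B) -> dvdIdeal P A \/ dvdIdeal P B.
Proof.
move=> [[fP PO] _ pP] [fA AO] [fB BO] /(dvdIdeal_sub fP) sub.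
have [subA|nsubA] := pselect (A `<=` P); first by left; apply/dvdIdealE.
right; apply/dvdIdealE => // b Bb.
have [a [Aa nPa]] : exists a, A a /\ ~ P a.
  by apply: contrapT => h; apply: nsubA => a Aa; apply: contrapT => ?; apply: h;
    exists a.
have Pab : P (a * b) by apply: sub; apply: mem_mulIdeal.
by case: (pP a b (AO _ Aa) (BO _ Bb) Pab).
Qed.

Lemma expIdeal_inv P J n : fracIdeal P -> fracIdeal J -> mulIdeal P J = O ->
  mulIdeal (expIdeal P n) (expIdeal J n) = O.
Proof.
move=> fP fJ PJ; elim: n => [|n IH]; first by rewrite mul1Ideal //; exact: fracIdealO.
by rewrite /= mulIdealACA PJ IH mul1Ideal //; exact: fracIdealO.
Qed.

(* If [C] were divisible by all powers of [P], the union [U] of the powers of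
   [P^-1] would be a fractional ideal with [P^-1 U = U]. *)
Lemma primeIdeal_exp_nsub P C : primeIdeal P -> fracIdeal C ->
  exists m, ~ C `<=` expIdeal P m.
Proof.
move=> [[fP PO] nP1 _] fC; apply: contrapT => nex.
have sub m : C `<=` expIdeal P m by apply: contrapT => h; apply: nex; exists m.
have [J fJ PJ] := invertible fP.
have OJ : O `<=` J by rewrite -PJ -[X in _ `<=` X](mul1Ideal fJ); apply: mulIdealS.
have fE m := fracIdeal_exp m fJ.
pose U := [set x | exists m, expIdeal J m x].
have mono m k : expIdeal J m `<=` expIdeal J (k + m).
  elim: k => [|k IH] // x /IH Jx; rewrite addSn /=.
  by rewrite -[x]mul1r; apply: mem_mulIdeal => //; apply: OJ.
have fU : fracIdeal U.
  have [[c Cc c0] _ _ _] := fC; split.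
  - by exists 1; [exists 0%N; apply: integers1 | rewrite oner_eq0].
  - move=> x y [m Jx] [k Jy]; exists (k + m)%N; apply: fracIdealD => //.
      exact: mono.
    by rewrite addnC; apply: mono.
  - by move=> a x Oa [m Jx]; exists m; apply: fracIdealM.
  (* An element of [C] lies in every power of [P], so it is a denominator of all powers of [J] at
     once. *)
  - exists c; split=> // [|x [m Jx]]; first exact: (sub 0%N).
    by rewrite -(expIdeal_inv m fP fJ PJ); apply: mem_mulIdeal => //; apply: sub.
have JU : mulIdeal U J = mulIdeal U O.
  rewrite mulIdeal1 //; apply/seteqP; split.
    apply: mulIdeal_min; first exact: fracIdeal0.
      by move=> ? ?; apply: fracIdealD.
    by move=> x y [m Jx] Jy; exists m.+1; rewrite /= mulrC; apply: mem_mulIdeal.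
  by move=> x Ux; rewrite -[x]mulr1; apply: mem_mulIdeal => //; apply: OJ.
(* Cancelling [U] in [JU] gives [J] = [O], hence [P] = [P] [O] = [P] [J] = [O]. *)
apply: nP1; rewrite -(mulIdeal1 fP) -(mulIdealI fU fJ (@fracIdealO L) JU) PJ //.
Qed.

(** The least exponent at which the power of [P] fails to contain [C] is positive, since P^0 = [O].
    Its predecessor is the exponent sought: a further factor [P] in the cofactor would contradict
    the failure. *)
Lemma prime_factor_out P C : primeIdeal P -> intIdeal C ->
  exists m A, [/\ intIdeal A, ~ dvdIdeal P A & C = mulIdeal (expIdeal P m) A].
Proof.
move=> pP [fC CO]; have [[fP PO] _ _] := pP.
have fE m := fracIdeal_exp m fP.
have [|m] := @ex_minnP (fun m => ~~ `[< C `<=` expIdeal P m >]).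
  by have [m nsub] := primeIdeal_exp_nsub pP fC; exists m; apply/asboolPn.
case: m => [/asboolPn[]//|m /asboolPn nsub min].
have sub : C `<=` expIdeal P m.
  by apply/asboolP; apply: contraT => /min; rewrite ltnn.
have [A iA CE] := (dvdIdealE (fE m) fC).2 sub.
exists m, A; split=> // -[B iB AE]; apply: nsub.
apply: (dvdIdeal_sub (fE _)); exists B => //=.
by rewrite CE AE mulIdealA [mulIdeal P _]mulIdealC.
Qed.

(** The relation from which [valuation] picks a value; existence and uniqueness are proved for it
    separately. *)
Definition hasValuation P I (k : int) : Prop := exists m n A B,
  [/\ k = m%:Z - n%:Z, intIdeal A /\ ~ dvdIdeal P A, intIdeal B /\ ~ dvdIdeal P B
    & mulIdeal (mulIdeal (expIdeal P n) B) I = mulIdeal (expIdeal P m) A].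

(** For a denominator [d] of [I], factor [P] out of the integral ideals ([d]) and [d] [I]. *)
Lemma hasValuation_exists P I : primeIdeal P -> fracIdeal I ->
  exists k, hasValuation P I k.
Proof.
move=> pP fI; have [_ _ _ [d [Od d0 dI]]] := fI.
have iD := intIdeal_principal Od d0.
have iC : intIdeal (mulIdeal (principal d) I).
  split; first by apply: fracIdeal_mul => //; case: iD.
  by rewrite mem_mul_principal // => _ [y Iy <-]; apply: dI.
have [m [A [iA nA CE]]] := prime_factor_out pP iC.
have [n [B [iB nB DE]]] := prime_factor_out pP iD.
by exists (m%:Z - n%:Z), m, n, A, B; rewrite -DE.
Qed.

(** If m < n, cancelling P^m leaves [A] = P^(n - m) [B], a multiple of [P]. *)
Lemma prime_exp_le P A B m n : primeIdeal P -> intIdeal A -> intIdeal B ->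
  ~ dvdIdeal P A -> mulIdeal (expIdeal P m) A = mulIdeal (expIdeal P n) B ->
  (n <= m)%N.
Proof.
move=> pP iA iB nA e; rewrite leqNgt; apply/negP => lt_mn.
have [[fP PO] _ _] := pP; apply: nA; exists (mulIdeal (expIdeal P (n - m).-1) B).
  by apply: intIdeal_mul => //; apply: intIdeal_exp.
apply: (mulIdealI (fracIdeal_exp m fP)); [by case: iA | |].
  by do 2![apply: fracIdeal_mul => //]; [apply: fracIdeal_exp | case: iB].
by rewrite e -{1}(subnKC (ltnW lt_mn)) expIdealD // -(prednK (n := n - m)) ?subn_gt0
  //= !mulIdealA.
Qed.

Lemma hasValuationD P I J k l : primeIdeal P -> fracIdeal I -> fracIdeal J ->
  hasValuation P I k -> hasValuation P J l -> hasValuation P (mulIdeal I J) (k + l).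
Proof.
move=> pP fI fJ [m [n [A [B [-> [iA nA] [iB nB] eI]]]]].
move=> [m' [n' [A' [B' [-> [iA' nA'] [iB' nB'] eJ]]]]].
have [[fP _] _ _] := pP.
exists (m + m')%N, (n + n')%N, (mulIdeal A A'), (mulIdeal B B'); split.
- by rewrite !PoszD; ring.
- by split; [apply: intIdeal_mul | move/prime_dvd_mul => []].
- by split; [apply: intIdeal_mul | move/prime_dvd_mul => []].
- by rewrite !expIdealD // [X in mulIdeal X _ = _]mulIdealACA mulIdealACA eI eJ
  mulIdealACA.
Qed.

Lemma hasValuation_unique P I k l : primeIdeal P -> fracIdeal I ->
  hasValuation P I k -> hasValuation P I l -> k = l.
Proof.
move=> pP fI [m [n [A [B [-> [iA nA] [iB nB] eI]]]]].
move=> [m' [n' [A' [B' [-> [iA' nA'] [iB' nB'] eI']]]]].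
have [[fP _] _ _] := pP.
have e : mulIdeal (expIdeal P (m + n')) (mulIdeal A B') =
         mulIdeal (expIdeal P (m' + n)) (mulIdeal A' B).
  rewrite !expIdealD // [LHS]mulIdealACA [RHS]mulIdealACA -eI -eI'.
  by rewrite -[LHS]mulIdealA [LHS]mulIdealC [X in mulIdeal X _]mulIdealC.
have iAB' := intIdeal_mul iA iB'; have iA'B := intIdeal_mul iA' iB.
have le1 : (m' + n <= m + n')%N.
  by apply: (prime_exp_le pP iAB' iA'B) e; move/prime_dvd_mul => [].
have le2 : (m + n' <= m' + n)%N.
  by apply: (prime_exp_le pP iA'B iAB') (esym e); move/prime_dvd_mul => [].
apply/eqP; rewrite subr_eq addrAC eq_sym subr_eq -!PoszD eqz_nat eqn_leq.
by rewrite le1.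
Qed.

Lemma valuationP P I k : primeIdeal P -> fracIdeal I ->
  valuation P I = k <-> hasValuation P I k.
Proof.
move=> pP fI; have hv : hasValuation P I (valuation P I).
  exact: xgetPex (hasValuation_exists pP fI).
by split=> [<-//|h]; apply: (hasValuation_unique pP fI).
Qed.

Lemma valuation_mul P I J : primeIdeal P -> fracIdeal I -> fracIdeal J ->
  valuation P (mulIdeal I J) = valuation P I + valuation P J.
Proof.
move=> pP fI fJ; apply/(valuationP _ pP); first exact: fracIdeal_mul.
by apply: hasValuationD => //; apply/valuationP.
Qed.

(** [A] may be divisible by [P] here: what serves later is an integral ideal [B] outside [P] that
    carries [I] into [O]. *)
Lemma valuation_ge0P P I : primeIdeal P -> fracIdeal I ->
  0 <= valuation P I <->
  exists A B, [/\ intIdeal A, intIdeal B, ~ dvdIdeal P B & mulIdeal B I = A].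
Proof.
move=> pP fI; have [iP _ _] := pP; have [fP _] := iP; split; last first.
  move=> [A [B [iA iB nB e]]]; have [m [A' [iA' nA' AE]]] := prime_factor_out pP iA.
  suff -> : valuation P I = m%:Z by [].
  apply/valuationP => //; exists m, 0%N, A', B; split=> //; first by rewrite subr0.
  by rewrite mul1Ideal -?AE //; case: iB.
have /valuationP h := erefl (valuation P I).
have [m [n [A [B [kE [iA nA] [iB nB] e]]]]] := h pP fI.
rewrite kE subr_ge0 lez_nat => le_nm; exists (mulIdeal (expIdeal P (m - n)) A), B.
split=> //; first by apply: intIdeal_mul => //; apply: intIdeal_exp.
have [[fA _] [fB _]] := (iA, iB).
apply: (mulIdealI (fracIdeal_exp n fP)).
- exact: fracIdeal_mul.
- by apply: fracIdeal_mul => //; apply: fracIdeal_exp.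
- by rewrite !mulIdealA e -expIdealD // subnKC.
Qed.

Lemma valuation_int_ge0 P I : primeIdeal P -> intIdeal I -> 0 <= valuation P I.
Proof.
move=> pP iI; have [fI _] := iI; apply/valuation_ge0P => //.
exists I, O; rewrite mul1Ideal //; split=> //; first exact: intIdealO.
have [[fP _] nP1 _] := pP; move=> /(dvdIdeal_sub fP) h.
by apply: nP1; apply: h.
Qed.

Lemma valuation_coprime P I : primeIdeal P -> intIdeal I -> ~ I `<=` P ->
  valuation P I = 0.
Proof.
move=> pP iI nIP; have [[fI _] [[fP _] nP1 _]] := (iI, pP).
apply/valuationP => //; exists 0%N, 0%N, I, O; split; rewrite ?mul1Ideal //.
- by split=> // /(dvdIdeal_sub fP).
- split; first exact: intIdealO.
  by move=> /(dvdIdeal_sub fP) h; apply: nP1; apply: h.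
- exact: fracIdealO.
Qed.

Lemma valuation0P P I : primeIdeal P -> fracIdeal I -> valuation P I = 0 ->
  exists A B, [/\ intIdeal A /\ ~ A `<=` P, intIdeal B /\ ~ B `<=` P
                & mulIdeal B I = A].
Proof.
move=> pP fI /valuationP; case=> // m [n [A [B [/esym/eqP]]]].
rewrite subr_eq0 eqz_nat => /eqP <- [iA nA] [iB nB] e.
have [[[fA _] [fB _]] [[fP _] _ _]] := (iA, iB, pP).
exists A, B; split; [by split=> // ?; apply/nA/dvdIdealE | by split=> // ?;
  apply/nB/dvdIdealE |].
apply: (mulIdealI (fracIdeal_exp m fP)) => //; first exact: fracIdeal_mul.
by rewrite mulIdealA.
Qed.

End Valuations.

(** * Ray classes *)

Section RayClasses.

Variables (L : fieldType) (N : nat).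
Implicit Types (x y z a b : L) (I J H P : set L).

Local Notation O := (ringOfIntegers L).

(* Being nonzero is a condition only when [N] is a unit. *)
Definition congOne x : Prop := [/\ O x, x != 0 & dvdO N%:R (x - 1)].

Hypothesis invertible : invertibleIdeals L.
Hypothesis denominators : forall x, exists2 d, O d /\ d != 0 & O (d * x).
Hypothesis N_neq0 : N%:R != 0 :> L.

Lemma intIdeal_of I : (exists2 x, I x & x != 0) ->
  (forall x y, I x -> I y -> I (x + y)) ->
  (forall a x, O a -> I x -> I (a * x)) -> I `<=` O -> intIdeal I.
Proof.
move=> I0 ID IM IO; split=> //; split=> //; exists 1; rewrite oner_eq0.
by split=> // x /IO; rewrite mul1r.
Qed.

(** Joining [I] to each set makes the empty chain harmless in Zorn's lemma: its union is empty, and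
    what remains is the proper ideal [I]. *)
Lemma intIdeal_bigcup I (F : set (set L)) : intIdeal I -> ~ I 1 ->
  (forall X, F X -> intIdeal (I `|` X) /\ ~ (I `|` X) 1) -> total_on F subset ->
  intIdeal (I `|` \bigcup_(X in F) X) /\ ~ (I `|` \bigcup_(X in F) X) 1.
Proof.
move=> iI nI1 FP Ft; split; last first.
  by case=> // -[X /FP[_ nX1] X1]; apply: nX1; right.
have [fI IO] := iI.
apply: intIdeal_of; first by case: fI => [[x Ix x0] _ _ _]; exists x => //; left.
- move=> x y [Ix|[X FX Xx]] [Iy|[Y FY Yy]].
  + by left; apply: fracIdealD.
  + have [[fY _] _] := FP Y FY.
    have [?|?] : (I `|` Y) (x + y) by apply: fracIdealD; [|left|right].
      by left.
    by right; exists Y.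
  + have [[fX _] _] := FP X FX.
    have [?|?] : (I `|` X) (x + y) by apply: fracIdealD; [|right|left].
      by left.
    by right; exists X.
  + wlog sXY : x y X Y FX FY Xx Yy / X `<=` Y => [wl|].
      have [sXY|sYX] := Ft X Y FX FY; first exact: (wl x y X Y).
      by rewrite addrC; apply: (wl y x Y X).
    have [[fY _] _] := FP Y FY.
    have [?|?] : (I `|` Y) (x + y) by apply: fracIdealD => //; right => //; apply: sXY.
      by left.
    by right; exists Y.
- move=> a x Oa [Ix|[X FX Xx]]; first by left; apply: fracIdealM.
  have [[fX _] _] := FP X FX.
  have [?|?] : (I `|` X) (a * x) by apply: fracIdealM => //; right.
    by left.
  by right; exists X.
- by move=> x [/IO//|[X FX Xx]]; have [[_ XO] _] := FP X FX; apply: XO; right.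
Qed.

Lemma intIdeal_add_principal I x : intIdeal I -> O x ->
  intIdeal [set z | exists y a, [/\ I y, O a & z = y + a * x]].
Proof.
move=> [fI IO] Ox; apply: intIdeal_of.
- have [[y Iy y0] _ _ _] := fI; exists y => //; exists y, 0; split=> //.
  by rewrite mul0r addr0.
- move=> _ _ [y [a [Iy Oa ->]]] [z [b [Iz Ob ->]]].
  exists (y + z), (a + b); split; [exact: fracIdealD | exact: integersD |].
  by rewrite mulrDl addrACA.
- move=> c _ Oc [y [a [Iy Oa ->]]]; exists (c * y), (c * a).
  by split; [exact: fracIdealM | exact: integersM | rewrite mulrDr mulrA].
- by move=> _ [y [a [/IO Oy Oa ->]]]; apply: integersD => //; apply: integersM.
Qed.

Lemma prime_above I : intIdeal I -> ~ I 1 -> exists2 P, primeIdeal P & I `<=` P.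
Proof.
move=> iI nI1.
have [|A [[iM nM1] Amax]] :=
  @Zorn_bigcup L [set X | intIdeal (I `|` X) /\ ~ (I `|` X) 1].
  by move=> F FP Ft; apply: intIdeal_bigcup.
have [fM MO] := iM; exists (I `|` A); last by left.
split=> // x y Ox Oy Mxy; apply: contrapT => /not_orP[nMx nMy].
pose M' := [set z | exists u a, [/\ (I `|` A) u, O a & z = u + a * x]].
have sM : I `|` A `<=` M' by move=> u Mu; exists u, 0; split=> //; rewrite mul0r addr0.
have M'x : M' x by exists 0, 1; rewrite add0r mul1r; split=> //; apply: fracIdeal0.
have /Amax : A `<` M'.
  split; first by move=> u Au; apply: sM; right.
  by move=> sub; apply: nMx; right; apply: sub.
have IM' : I `|` M' = M' by apply/setUidr; apply: subset_trans sM => ?; left.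
apply; rewrite /mkset IM'.
split; first exact: intIdeal_add_principal.
(* If 1 = u + a x with u in the maximal ideal, then y = u y + a (x y) is in it too. *)
move=> [u [a [Mu Oa e]]]; apply: nMy.
rewrite -[y]mul1r e mulrDl -mulrA mulrC.
by apply: fracIdealD => //; apply: fracIdealM.
Qed.

Lemma mem_primeDivisor P : primeDivisor N P -> P N%:R.
Proof. by move=> [[[fP _] _ _] /(dvdIdeal_sub fP)]; apply; apply: mem_principal. Qed.

Lemma congOne_notin P x : primeDivisor N P -> congOne x -> ~ P x.
Proof.
move=> dP [Ox x0 [q Oq e]] Px; have PN := mem_primeDivisor dP.
have [[[fP _] nP1 _] _] := dP; apply: nP1.
have -> : 1 = x - q * N%:R by rewrite -e opprB addrC subrK.
by apply: fracIdealB => //; apply: fracIdealM.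
Qed.

Lemma congOneM x y : congOne x -> congOne y -> congOne (x * y).
Proof.
move=> [Ox x0 [q Oq ex]] [Oy y0 [r Or ey]]; split;
  [exact: integersM | by rewrite mulf_neq0 |].
exists (q * y + r); first by apply: integersD => //; apply: integersM.
by rewrite mulrDl -ey mulrAC -ex; ring.
Qed.

Lemma congOne1 : congOne 1.
Proof. by split=> //; [rewrite oner_eq0 | exists 0 => //; rewrite mul0r subrr]. Qed.

Lemma congOneD x y : congOne x -> O y -> x + y * N%:R != 0 -> congOne (x + y * N%:R).
Proof.
move=> [Ox x0 [q Oq ex]] Oy s0; split=> //.
  by apply: integersD => //; apply: integersM => //; apply: integers_nat.
by exists (q + y); [apply: integersD | rewrite mulrDl -ex addrAC].
Qed.

Lemma congOne_lift I c : intIdeal I -> O c -> I (1 - c * N%:R) ->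
  exists2 a, I a & congOne a.
Proof.
(* If this element vanishes, [N] is a unit, every congruence modulo [N] holds, and any nonzero
   element of [I] will do. *)
move=> [fI IO] Oc Ic; have [e0|ne0] := eqVneq (1 - c * N%:R) 0.
  have [[x Ix x0] _ _ _] := fI; exists x => //; split=> //; first exact: IO.
  exists ((x - 1) * c); last by rewrite -mulrA -(subr0_eq e0) mulr1.
  by apply: integersM => //; apply: integersB => //; apply: IO.
exists (1 - c * N%:R) => //; split=> //; first exact: IO.
by exists (- c); [exact: integersN | rewrite mulNr addrAC subrr add0r].
Qed.

(** If [I] + ([N]) were proper, a prime above it would divide [N] and contain [I]. So 1 = y + c [N]
    with y in [I]. *)
Lemma coprime_congOne I : intIdeal I ->
  (forall P, primeDivisor N P -> ~ I `<=` P) -> exists2 a, I a & congOne a.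
Proof.
move=> iI nsub; have ON := @integers_nat L N.
have iS := intIdeal_add_principal iI ON.
pose S := [set z | exists y a, [/\ I y, O a & z = y + a * N%:R]].
have [[y [c [Iy Oc e]]]|nS1] := pselect (S 1).
  by apply: (congOne_lift iI Oc); rewrite {1}e addrK.
have [P pP sP] := prime_above iS nS1; have [[fP _] _ _] := pP.
have [fI _] := iI.
case: (nsub P); last by move=> y Iy; apply: sP; exists y, 0; rewrite mul0r addr0.
split=> //; apply/(dvdIdealE invertible fP); first by case: (intIdeal_principal ON
  N_neq0).
move=> _ [a Oa <-]; apply: sP; exists 0, a; rewrite add0r; split=> //.
exact: fracIdeal0.
Qed.

(** * Valuations at the primes dividing [N] as congruences *)

(** The local conditions become global through the ideal of all denominators of [I]: no prime
    dividing [N] contains it, so some denominator is congruent to 1. *)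
Lemma idealsPrimeToP I : fracIdeal I -> idealsPrimeTo N I <->
  exists a b, [/\ congOne a, congOne b, (forall x, I x -> O (b * x)) & I (a / b)].
Proof.
move=> fI; split=> [[_ v0]|[a [b [ca cb bI Iab]]]].
  pose D := [set x | O x /\ forall y, I y -> O (x * y)].
  have iD : intIdeal D.
    apply: intIdeal_of; last by move=> x [].
    - by have [_ _ _ [d [Od d0 dI]]] := fI; exists d.
    - move=> x y [Ox xI] [Oy yI]; split=> [|z Iz]; first exact: integersD.
      by rewrite mulrDl; apply: integersD; [apply: xI | apply: yI].
    - move=> a x Oa [Ox xI]; split=> [|z Iz]; first exact: integersM.
      by rewrite -mulrA; apply: integersM => //; apply: xI.
  have [b [Ob bI] cb] : exists2 b, D b & congOne b.
    apply: coprime_congOne => // P dP; have [pP _] := dP.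
    have [A [B [[[_ AO] _] [[fB BO] nB] e]]] := valuation0P invertible pP fI (v0 P dP).
    (* [B] lies in [D] because [B] [I] = [A] is integral, but [B] is not inside [P]. *)
    move=> sDP; apply: nB => y By; apply: sDP; split=> [|z Iz]; first exact: BO.
    by apply: AO; rewrite -e; apply: mem_mulIdeal.
  have [_ b0 _] := cb.
  have fbI : fracIdeal (mulIdeal (principal b) I).
    by apply: fracIdeal_mul => //; case: (intIdeal_principal Ob b0).
  have bIE := mem_mul_principal b fI.
  have ibI : intIdeal (mulIdeal (principal b) I).
    by split=> //; rewrite bIE => _ [y Iy <-]; apply: bI.
  have [a bIa ca] : exists2 a, mulIdeal (principal b) I a & congOne a.
    apply: coprime_congOne => // P dP sbIP; have [pP _] := dP.
    have [A [B [[[_ AO] nA] [[fB BO] nB] e]]] := valuation0P invertible pP fI (v0 P dP).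
    have [[fP PO] _ mP] := pP; apply: nA => y Ay.
    (* Then [b] [A] = [b] [I] [B] would lie in [P], which is prime and contains neither [b] nor
       [A]. *)
    suff sub : mulIdeal (mulIdeal (principal b) I) B `<=` P.
      have Pby : P (b * y).
        apply: sub; rewrite -mulIdealA [mulIdeal I B]mulIdealC e.
        by apply: mem_mulIdeal => //; apply: mem_principal.
      by case: (mP b y Ob (AO _ Ay) Pby) => // /(congOne_notin dP cb).
    apply: mulIdeal_min => [|u v Pu Pv|u v /sbIP Pu /BO Ov].
    - exact: fracIdeal0.
    - exact: fracIdealD.
    - by rewrite mulrC; apply: fracIdealM.
  exists a, b; split=> //.
  by move: bIa; rewrite bIE => -[y Iy <-]; rewrite mulrC mulKf.
split=> // P dP; have [pP _] := dP; have [[Oa a0 _] [Ob b0 _]] := (ca, cb).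
have ib := intIdeal_principal Ob b0; have [fb _] := ib.
have bIE := mem_mul_principal b fI.
have ibI : intIdeal (mulIdeal (principal b) I).
  by split; [exact: fracIdeal_mul | rewrite bIE => _ [y Iy <-]; apply: bI].
(* Both ([b]) and [b] [I] are integral and not inside [P]; their valuations vanish, hence so does
   that of [I]. *)
have /(valuation_coprime invertible pP ibI) : ~ mulIdeal (principal b) I `<=` P.
  move=> sub; apply: (congOne_notin dP ca); apply: sub; rewrite bIE.
  by exists (a / b) => //; rewrite mulrC divfK.
rewrite (valuation_mul invertible) // (valuation_coprime invertible pP ib) ?add0r //.
by move=> sub; apply: (congOne_notin dP cb); apply: sub; apply: mem_principal.
Qed.

Lemma fracIdeal_principal_neq0 x : x != 0 -> fracIdeal (principal x).
Proof.
by move=> x0; have [d [Od d0] Odx] := denominators x; apply: fracIdeal_principal Odx.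
Qed.

(** The ray condition says that (x - 1) / [N] is integral at the primes dividing [N]. It thus has a
    denominator b = 1 (mod [N]), and then b x = b + b (x - 1) = 1 (mod [N]), so x = (b x) / b. *)
Lemma rayPrincipalP J : rayPrincipal N J <->
  exists a b, [/\ congOne a, congOne b & J = principal (a / b)].
Proof.
have fN := fracIdeal_principal_neq0 N_neq0.
split=> [[x [x0 xc] <-]|[a [b [ca cb ->]]]]; last first.
  have [[Oa a0 [q Oq ea]] [Ob b0 [r Or eb]]] := (ca, cb).
  exists (a / b) => //; split=> [|P dP]; first by rewrite mulf_neq0 ?invr_eq0.
  rewrite divr1; have [->|ne0] := eqVneq (a / b - 1) 0; first by left.
  right; have [pP _] := dP.
  have e : b * (a / b - 1) = N%:R * (q - r).
    by rewrite mulrBr mulr1 mulrC divfK // mulrBr ![N%:R * _]mulrC -ea -eb; ring.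
  have c0 : q - r != 0.
    by apply: contra_neq ne0 => c0; apply: (mulfI b0); rewrite e c0 !mulr0.
  have iqr := intIdeal_principal (integersB Oq Or) c0; have [fqr _] := iqr.
  have ib := intIdeal_principal Ob b0; have [fb _] := ib.
  have := valuation_mul invertible pP fb (fracIdeal_principal_neq0 ne0).
  rewrite principalM e -principalM (valuation_mul invertible) //.
  rewrite (valuation_coprime invertible pP ib) ?add0r => [<-|sub].
    by rewrite lerDl (valuation_int_ge0 invertible).
  by apply: (congOne_notin dP cb); apply: sub; apply: mem_principal.
(* The case x = 1 is set apart because [y] must generate a fractional ideal, hence be nonzero. *)
have [->|x1] := eqVneq x 1.
  by exists 1, 1; split; [exact: congOne1 | exact: congOne1 | rewrite divr1].
rewrite -subr_eq0 in x1; pose y := (x - 1) / N%:R.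
have y0 : y != 0 by rewrite mulf_neq0 ?invr_eq0.
have fy := fracIdeal_principal_neq0 y0.
have Ny : N%:R * y = x - 1 by rewrite mulrC divfK.
pose D := [set d | O d /\ O (d * y)].
have iD : intIdeal D.
  apply: intIdeal_of; last by move=> d [].
  - by have [d [Od d0] Ody] := denominators y; exists d.
  - move=> d e [Od Ody] [Oe Oey]; split; first exact: integersD.
    by rewrite mulrDl; apply: integersD.
  - move=> c d Oc [Od Ody]; split; first exact: integersM.
    by rewrite -mulrA; apply: integersM.
have [b [Ob Oby] cb] : exists2 b, D b & congOne b.
  apply: coprime_congOne => // P dP; have [pP _] := dP.
  have [/eqP|] := xc P dP; first by rewrite divr1 (negPf x1).
  rewrite divr1 -Ny -principalM (valuation_mul invertible) // lerDl.
  move=> /(valuation_ge0P invertible pP fy)[A [B [[_ AO] [fB BO] nB e]]] sDP.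
  apply: nB; have [[fP _] _ _] := pP; apply/(dvdIdealE invertible) => // z Bz.
  apply: sDP; split; first exact: BO.
  by apply: AO; rewrite -e; apply: mem_mulIdeal => //; apply: mem_principal.
have [_ b0 _] := cb.
have bx : b + (b * y) * N%:R = b * x by rewrite mulrAC -mulrA Ny mulrBr mulr1 addrC
  subrK.
exists (b * x), b; split=> //; last by rewrite mulrAC mulfV ?mul1r.
by rewrite -bx; apply: congOneD => //; rewrite bx mulf_neq0.
Qed.

(** * The ray class group *)

Lemma rayPrincipal1 : rayPrincipal N O.
Proof.
apply/rayPrincipalP; exists 1, 1; rewrite divr1 principal1.
by split=> //; apply: congOne1.
Qed.

Lemma rayPrincipal_frac J : rayPrincipal N J -> fracIdeal J.
Proof. by case=> x [x0 _] <-; apply: fracIdeal_principal_neq0. Qed.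

Lemma rayPrincipalM I J :
  rayPrincipal N I -> rayPrincipal N J -> rayPrincipal N (mulIdeal I J).
Proof.
move=> /rayPrincipalP[a [b [ca cb ->]]] /rayPrincipalP[c [d [cc cd ->]]].
apply/rayPrincipalP; exists (a * c), (b * d).
by rewrite principalM mulf_div; split=> //; apply: congOneM.
Qed.

Lemma rayPrincipal_inv J : rayPrincipal N J ->
  exists2 J', rayPrincipal N J' & mulIdeal J J' = O.
Proof.
move=> /rayPrincipalP[a [b [ca cb ->]]]; exists (principal (b / a)).
  by apply/rayPrincipalP; exists b, a.
have [[_ a0 _] [_ b0 _]] := (ca, cb).
by rewrite principalM mulf_div [a * b]mulrC divff ?principal1 // mulf_neq0.
Qed.

Lemma rayClassP I J : fracIdeal I -> fracIdeal J ->
  rayClass N I = rayClass N J <-> exists2 H, rayPrincipal N H & J = mulIdeal I H.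
Proof.
move=> fI fJ; split=> [e|[H rH ->]].
  have : rayClass N J J by exists O; [exact: rayPrincipal1 | rewrite mulIdeal1].
  by rewrite -e => -[H rH <-]; exists H.
have [H' rH' HH'] := rayPrincipal_inv rH; have fH' := rayPrincipal_frac rH'.
apply/seteqP; split=> _ [A rA <-]; have fA := rayPrincipal_frac rA.
  exists (mulIdeal H' A); first exact: rayPrincipalM.
  by rewrite mulIdealA -[X in mulIdeal X A]mulIdealA HH' mulIdeal1.
by exists (mulIdeal H A); [exact: rayPrincipalM | rewrite mulIdealA].
Qed.

Lemma mulRayClassE I J : fracIdeal I -> fracIdeal J ->
  mulRayClass (rayClass N I) (rayClass N J) = rayClass N (mulIdeal I J).
Proof.
move=> fI fJ; apply/seteqP; split.
  move=> _ [_ [A rA <-] [_ [B rB <-] <-]]; exists (mulIdeal A B).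
    exact: rayPrincipalM.
  exact: mulIdealACA.
move=> _ [A rA <-]; exists (mulIdeal I A); first by exists A.
exists J; last by rewrite mulIdealAC.
by exists O; [exact: rayPrincipal1 | rewrite mulIdeal1].
Qed.

Lemma idealsPrimeToM I J :
  idealsPrimeTo N I -> idealsPrimeTo N J -> idealsPrimeTo N (mulIdeal I J).
Proof.
move=> [fI vI] [fJ vJ]; split=> [|P dP]; first exact: fracIdeal_mul.
by have [pP _] := dP; rewrite (valuation_mul invertible) ?vI ?vJ.
Qed.

Lemma idealsPrimeTo1 : idealsPrimeTo N O.
Proof.
split=> [|P [pP _]]; first exact: fracIdealO.
apply: (valuation_coprime invertible) => //; first exact: intIdealO.
by have [_ nP1 _] := pP => h; apply: nP1; apply: h.
Qed.

Lemma idealsPrimeTo_inv I : idealsPrimeTo N I ->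
  exists2 J, idealsPrimeTo N J & mulIdeal I J = O.
Proof.
move=> [fI vI]; have [J fJ IJ] := invertible fI; exists J => //; split=> // P dP.
have [_ vO] := idealsPrimeTo1; have [pP _] := dP; have := vO P dP.
by rewrite -IJ (valuation_mul invertible) // vI ?add0r.
Qed.

Lemma rayClassGroup_isGroup : isGroupOn (rayClassGroup L N) (@mulRayClass L).
Proof.
have f I : idealsPrimeTo N I -> fracIdeal I by case.
split.
- move=> _ _ [I pI <-] [J pJ <-]; rewrite mulRayClassE; [|exact: f..].
  by exists (mulIdeal I J) => //; apply: idealsPrimeToM.
- move=> _ _ _ [I pI <-] [J pJ <-] [H pH <-].
  have [[fI fJ] fH] := ((f _ pI, f _ pJ), f _ pH).
  by do 4![rewrite mulRayClassE ?mulIdealA //; try exact: fracIdeal_mul].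
- exists (rayClass N O); split; first by exists O => //; apply: idealsPrimeTo1.
    move=> _ [I pI <-]; have [fI fO] := (f _ pI, @fracIdealO L).
    by rewrite !mulRayClassE // mul1Ideal // mulIdeal1.
  move=> _ [I pI <-]; have [J pJ IJ] := idealsPrimeTo_inv pI.
  exists (rayClass N J); split; first by exists J.
    by rewrite mulRayClassE ?[mulIdeal J I]mulIdealC ?IJ //; apply: f.
  by rewrite mulRayClassE ?IJ //; apply: f.
Qed.

End RayClasses.

(** * Principal ideal domains *)

Section PrincipalIdealDomain.

Variable L : fieldType.
Implicit Types (a b c g n u v x y z : L).

Local Notation O := (ringOfIntegers L).

(** Bezout form of coprimality: it passes to products by mere multiplication, and it turns into
    [gcd_one] and back only where divisors matter. *)
Definition comaximal a b : Prop := exists x y, [/\ O x, O y & x * a + y * b = 1].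

Lemma dvdO_refl a : dvdO a a.
Proof. by exists 1; rewrite ?mul1r. Qed.

Lemma dvdOD a b c : dvdO a b -> dvdO a c -> dvdO a (b + c).
Proof.
by move=> [p Op ->] [q Oq ->]; exists (p + q); [apply: integersD | rewrite mulrDl].
Qed.

Lemma dvdO_mull a b c : O c -> dvdO a b -> dvdO a (c * b).
Proof.
by move=> Oc [p Op ->]; exists (c * p); [apply: integersM | rewrite mulrA].
Qed.

Lemma dvdO1 x : O x -> dvdO x 1 -> unitO x.
Proof.
move=> Ox [q Oq e]; have x0 : x != 0.
  by apply: contra_eq_neq e => ->; rewrite mulr0 oner_eq0.
by split=> //; rewrite -[x^-1]mul1r e mulfK.
Qed.

Lemma unitOM x y : unitO x -> unitO y -> unitO (x * y).
Proof.
move=> [x0 Ox Ox1] [y0 Oy Oy1]; split; rewrite ?mulf_neq0 ?invfM //.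
  exact: integersM.
exact: integersM.
Qed.

Lemma unitOV x : unitO x -> unitO x^-1.
Proof. by move=> [x0 Ox Ox1]; split; rewrite ?invr_eq0 ?invrK. Qed.

Lemma unitO1 : unitO (1 : L).
Proof. by split; rewrite ?invr1 ?oner_eq0. Qed.

Lemma comaximal_gcd_one a b : comaximal a b -> gcd_one [:: a; b].
Proof.
move=> [x [y [Ox Oy e]]] g Og dg; apply: dvdO1 => //; rewrite -e.
by apply: dvdOD; apply: dvdO_mull => //; apply: dg; rewrite !inE eqxx ?orbT.
Qed.

Lemma comaximalM a b c : O a -> O b -> O c ->
  comaximal a b -> comaximal a c -> comaximal a (b * c).
Proof.
move=> Oa Ob Oc [x [y [Ox Oy e]]] [z [w [Oz Ow f]]].
exists (x * (z * a + w * c) + y * b * z), (y * w); split.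
- by rewrite f mulr1; apply: integersD => //; apply: integersM => //; apply: integersM.
- exact: integersM.
- by rewrite -[1]mulr1 -{1}e -f; ring.
Qed.

Lemma comaximalX a b k : O a -> O b -> comaximal a b -> comaximal a (b ^+ k).
Proof.
move=> Oa Ob cab; elim: k => [|k IH].
  by exists 0, 1; rewrite expr0 mul0r add0r mulr1.
by rewrite exprS; apply: comaximalM => //; apply: integersX.
Qed.

(** An inverse of [a] modulo [N], chosen so that the product stays nonzero even when [N] is a
    unit. *)
Lemma comaximal_congOne N a : O a -> a != 0 -> comaximal a N%:R ->
  exists2 x, O x & congOne N (x * a).
Proof.
move=> Oa a0 [x [y [Ox Oy e]]].
have [//|_ [z Oz <-] cz] := congOne_lift (N := N) (intIdeal_principal Oa a0) Oy.
  by exists x => //; rewrite -{1}e addrK.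
by exists z.
Qed.

Hypothesis pid : classNumberOne L.

Lemma gcd_exists a b : O a -> O b -> a != 0 ->
  exists g, [/\ dvdO g a, dvdO g b & exists x y, [/\ O x, O y & g = x * a + y * b]].
Proof.
move=> Oa Ob a0; pose I := [set z | exists x y, [/\ O x, O y & z = x * a + y * b]].
have Ia : I a by exists 1, 0; rewrite mul0r mul1r addr0.
have Ib : I b by exists 0, 1; rewrite mul0r mul1r add0r.
have [|g g0 IE] := pid (I := I); last first.
  rewrite IE in Ia Ib; have [[p Op pe] [q Oq qe]] := (Ia, Ib).
  exists g; split; [by exists p | by exists q |].
  by have : I g by rewrite IE; apply: mem_principal.
suff [] : intIdeal I by [].
apply: intIdeal_of; first by exists a.
- move=> _ _ [x [y [Ox Oy ->]]] [z [w [Oz Ow ->]]]; exists (x + z), (y + w).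
  by split; [apply: integersD | apply: integersD | ring].
- move=> c _ Oc [x [y [Ox Oy ->]]]; exists (c * x), (c * y).
  by split; [apply: integersM | apply: integersM | ring].
- by move=> _ [x [y [Ox Oy ->]]]; apply: integersD; apply: integersM.
Qed.

Lemma gcd_one_comaximal a b : O a -> O b -> a != 0 ->
  gcd_one [:: a; b] -> comaximal a b.
Proof.
move=> Oa Ob a0 cop; have [g [ga gb [x [y [Ox Oy ge]]]]] := gcd_exists Oa Ob a0.
have [|z|g0 Og Og1] := cop g.
- by rewrite ge; apply: integersD; apply: integersM.
- by rewrite !inE => /orP[/eqP->|/eqP->].
- exists (g^-1 * x), (g^-1 * y); split; [exact: integersM | exact: integersM |].
  by rewrite -!mulrA -mulrDr -ge mulVf.
Qed.

Lemma gcd_one_bezout3 a b c : O a -> O b -> O c -> a != 0 -> gcd_one [:: a; b; c] ->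
  exists x y z, [/\ O x, O y, O z & x * a + y * b + z * c = 1].
Proof.
move=> Oa Ob Oc a0 cop; have [g [[p Op pe] [q Oq qe] [x [y [Ox Oy ge]]]]] :=
  gcd_exists Oa Ob a0.
have Og : O g by rewrite ge; apply: integersD; apply: integersM.
have g0 : g != 0 by apply: contra_neq a0 => g0; rewrite pe g0 mulr0.
have [|z [w [Oz Ow e]]] := @gcd_one_comaximal g c Og Oc g0.
  move=> d Od dd; apply: cop => // t; rewrite !inE => /or3P[]/eqP->.
  - by rewrite pe; apply: dvdO_mull => //; apply: dd; apply: mem_head.
  - by rewrite qe; apply: dvdO_mull => //; apply: dd; apply: mem_head.
  - by apply: dd; rewrite !inE eqxx orbT.
exists (z * x), (z * y), w; split=> //; [exact: integersM | exact: integersM |].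
by rewrite -!mulrA -mulrDr -ge.
Qed.

(* [r] is the largest divisor of [v] prime to [u]: a prime of [v] dividing [u]
   divides neither [n] nor [r], and one not dividing [u] divides [r]. *)
Lemma stable_range u v n : O u -> O v -> O n -> v != 0 ->
  (exists x y z, [/\ O x, O y, O z & x * u + y * v + z * n = 1]) ->
  exists2 r, O r & comaximal (u + n * r) v.
Proof.
move=> Ou Ov On v0 [a [b [c [Oa Ob Oc abc]]]].
have OuX k := integersX k Ou.
pose I := [set x | O x /\ exists k, dvdO v (x * u ^+ k)].
have [|r r0 IE] := pid (I := I).
  suff [] : intIdeal I by [].
  apply: intIdeal_of; last by move=> x [].
  - by exists v => //; split=> //; exists 0%N; rewrite mulr1; apply: dvdO_refl.
  - move=> x y [Ox [k dx]] [Oy [l dy]]; split; first exact: integersD.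
    exists (k + l)%N; rewrite exprD mulrDl mulrA mulrC.
    by apply: dvdOD; [|rewrite mulrCA]; apply: dvdO_mull.
  - move=> e x Oe [Ox [k dx]]; split; first exact: integersM.
    by exists k; rewrite -mulrA; apply: dvdO_mull.
have [Or [k [q Oq qe]]] : I r by rewrite IE; apply: mem_principal.
(* Dividing [r] by its gcd with [u] stays in [I], at the price of one more factor [u]; as [r]
   generates [I], this gcd is a unit. *)
have cru : comaximal r u.
  have [g [[r1 Or1 r1e] [u1 Ou1 u1e] [x [y [Ox Oy ge]]]]] := gcd_exists Or Ou r0.
  have : I r1.
    split=> //; exists k.+1; exists (u1 * q); first exact: integersM.
    by rewrite -mulrA -qe exprS {1}u1e r1e; ring.
  rewrite IE => -[s Os se]; have g1 : s * g = 1.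
    by apply: (mulIf r0); rewrite mulrAC se mul1r.
  exists (s * x), (s * y); split; [exact: integersM | exact: integersM |].
  by rewrite -g1 ge; ring.
exists r => //; have [x [y [Ox Oy xy]]] := cru.
have Ow : O (u + n * r) by apply: integersD => //; apply: integersM.
(* This gcd is prime to [r] and to [u], yet it divides [v], which divides [r * u ^+ k]; so it is a
   unit. *)
have [g [[v' Ov' v'e] [w' Ow' w'e] [s [t [Os Ot ge]]]]] := gcd_exists Ov Ow v0.
have Og : O g by rewrite ge; apply: integersD; apply: integersM.
have cgr : comaximal g r.
  exists (y * w'), (x - y * n); split; first exact: integersM.
    by apply: integersB => //; apply: integersM.
  by rewrite -mulrA -w'e -xy; ring.
(* Modulo [g] one has v = 0 and n r = - u, so n = n (x r + y u) is a multiple of u; hence so is a u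
   + b v + c n = 1. *)
have cgu : comaximal g u.
  exists (b * v' + c * x * w'), (a + c * (n * y - x)); split.
  - by apply: integersD; do 2?[apply: integersM => //].
  - apply: integersD => //; apply: integersM => //.
    by apply: integersB => //; apply: integersM.
  - transitivity (b * (v' * g) + c * x * (w' * g) + (a + c * (n * y - x)) * u);
    first by ring.
    rewrite -w'e -v'e -abc -[X in _ = _ + _ + c * X]mulr1 -xy; ring.
have [X [Y [OX OY e]]] := comaximalM Og Or (OuX k) cgr (comaximalX k Og Ou cgu).
have Zg : (X + Y * q * v') * g = 1.
  by rewrite -e qe v'e; ring.
exists ((X + Y * q * v') * t), ((X + Y * q * v') * s).
have OZ : O (X + Y * q * v') by apply: integersD => //; apply: integersM => //;
  apply: integersM.
by split; [exact: integersM | exact: integersM | rewrite -Zg ge; ring].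
Qed.

End PrincipalIdealDomain.

(** * Integers of number fields *)

Lemma integers_rmorph (F K : fieldType) (f : {rmorphism F -> K}) x :
  ringOfIntegers K (f x) <-> ringOfIntegers F x.
Proof.
have e : f \o intr =1 intr :> (int -> K) by move=> z /=; rewrite rmorph_int.
have e' (p : {poly int}) : map_poly intr p = map_poly f (map_poly intr p) :> {poly K}.
  by rewrite -map_poly_comp; apply/esym/eq_map_poly.
by split=> -[p p_monic]; rewrite ?e' ?fmorph_root => pr; exists p;
  rewrite ?e' ?fmorph_root.
Qed.

(* With [l] the leading coefficient of [q] and [n] its degree,
   [l^(n-1) q(X / l)] is monic with integer coefficients. *)
Lemma integers_lead_coef_mul (F : fieldType) (q : {poly int}) (x : F) :
  (lead_coef q)%:~R != 0 :> F -> root (map_poly intr q) x ->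
  ringOfIntegers F ((lead_coef q)%:~R * x).
Proof.
set l := lead_coef q => l0 qx.
have q0 : q != 0 by apply: contra_neq l0; rewrite /l => ->; rewrite lead_coef0.
pose n := (size q).-1; have sq : size q = n.+1 by rewrite prednK // lt0n size_poly_eq0.
pose a i := if i == n then 1 else q`_i * l ^+ (n.-1 - i).
exists (\poly_(i < n.+1) a i).
  by rewrite monicE lead_coef_poly // /a eqxx.
have : (map_poly intr q).[x] = 0 by apply/rootP.
rewrite (@horner_coef_wide _ n.+1) => [sum0|]; last first.
  by apply: leq_trans (size_poly _ _) _; rewrite -sq.
apply/rootP/(mulfI l0); rewrite mulr0 (@horner_coef_wide _ n.+1); last first.
  by apply: leq_trans (size_poly _ _) _; exact: size_poly.
transitivity (l%:~R ^+ n * \sum_(i < n.+1) (map_poly intr q)`_i * x ^+ i : F).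
  rewrite !mulr_sumr.
  apply: eq_bigr => -[i lt_in] _ /=; rewrite !coef_map coef_poly lt_in /a /=.
case: eqP => [-> | /eqP ni].
  by rewrite mul1r exprMn -/(lead_coef q) mulrA -exprS exprSr -mulrA.
have lt : (i < n)%N by rewrite ltn_neqAle ni -ltnS.
rewrite intrM rmorphXn /= exprMn.
have -> : (l%:~R : F) ^+ n = l%:~R * (l%:~R ^+ (n.-1 - i) * l%:~R ^+ i).
  by rewrite -exprD subnK -?exprS ?prednK ?(leq_ltn_trans _ lt) // -ltnS prednK
    ?(leq_ltn_trans _ lt).
by ring.
by rewrite sum0 mulr0.
Qed.

Lemma natr_neq0_numField (F : fieldExtType rat) n : (0 < n)%N -> n%:R != 0 :> F.
Proof.
by move=> n0; rewrite -[n%:R](rmorph_nat (in_alg F)) fmorph_eq0 pnatr_eq0 -lt0n.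
Qed.

(** The denominator is the leading coefficient of an integer multiple of the minimal polynomial of
    [x]. *)
Lemma denominators_numField (F : fieldExtType rat) (x : F) :
  exists2 d : F, ringOfIntegers F d /\ d != 0 & ringOfIntegers F (d * x).
Proof.
have /polyOver1P[p pE] := minPolyOver 1 x.
have [q [a a0 qE]] := rat_poly_scale p.
have intrE : in_alg F \o intr =1 intr by move=> z; apply: (rmorph_int (in_alg F)).
have qx : root (map_poly intr q) x.
  have : root (map_poly (in_alg F) p) x by rewrite -pE root_minPoly.
  rewrite qE linearZ /= rootZ; last by rewrite (fmorph_eq0 (in_alg F)) invr_eq0
    intr_eq0.
  by rewrite -map_poly_comp (eq_map_poly intrE).
have l0 : (lead_coef q)%:~R != 0 :> F.
  rewrite -[_%:~R](rmorph_int (in_alg F)) fmorph_eq0 intr_eq0 lead_coef_eq0.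
  apply: contraTneq (monic_minPoly 1 x) => q0.
  by rewrite pE qE q0 !rmorph0 scaler0 rmorph0 monicE lead_coef0 eq_sym oner_eq0.
exists ((lead_coef q)%:~R : F); last by apply: integers_lead_coef_mul.
split=> //; exact: integral_id.
Qed.

Lemma integers_quadratic (L : fieldType) (u p q : L) : ringOfIntegers L p ->
  ringOfIntegers L q -> u ^+ 2 + p * u + q = 0 -> ringOfIntegers L u.
Proof.
move=> Op Oq e; pose P : {poly L} := 'X^2 + (p *: 'X + q%:P).
have sz : (size (p *: 'X + q%:P)%R < 3)%N.
  rewrite (leq_ltn_trans (size_polyD _ _)) // gtn_max.
  rewrite (leq_ltn_trans (size_scale_leq _ _)) ?size_polyX //=.
  by rewrite (leq_ltn_trans (size_polyC_leq1 _)).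
apply: (@integral_root_monic _ _ _ u P).
- by rewrite monicE lead_coefDl ?size_polyXn // lead_coefXn.
- by apply/rootP; rewrite /P !hornerE.
- apply/integral_poly => i; rewrite /P !coefE.
  case: i => [|[|[|i]]] /=; rewrite ?mulr0 ?mulr1 ?add0r ?addr0.
  + exact: Oq.
  + exact: Op.
  + exact: integers1.
  + exact: integers0.
Qed.

(** * Lattices in a quadratic extension *)

Section QuadraticLattices.

Variables (F : fieldExtType rat) (K : fieldExtType F) (w : K) (b c : F).

Local Notation O := (ringOfIntegers F).
Local Notation OK := (ringOfIntegers K).
Local Notation "x %:K" := (in_alg K x) (at level 2, format "x %:K").
Implicit Types (a t x y : F) (z : K) (I : set K).

Hypothesis pid : classNumberOne F.
Hypothesis dimK : \dim {:K} = 2%N.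
Hypothesis integersK : OK = lattice w 1.
Hypothesis Ob : O b.
Hypothesis minPoly_w :
  minPoly 1%AS w = map_poly (in_alg K) ('X^2 + b *: 'X + c%:P).

Let OKb : OK b%:K. Proof. exact/integers_rmorph. Qed.

(** Scalings become products in [K], the form in which [ring] and [field] can work. *)
Lemma latticeP (z1 z2 z : K) :
  lattice z1 z2 z <-> exists x y, [/\ O x, O y & z = x%:K * z1 + y%:K * z2].
Proof.
by split=> -[x [y [Ox Oy ->]]]; exists x, y; split=> //; rewrite !mulr_algl.
Qed.

Lemma sqr_w : w ^+ 2 = - b%:K * w - c%:K.
Proof.
have := minPolyxx 1%AS w; rewrite minPoly_w !rmorphD /= map_polyXn map_polyZ.
rewrite map_polyX map_polyC /= !hornerE => /eqP.
by rewrite -addrA addr_eq0 opprD mulNr => /eqP.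
Qed.

(** With [x] nonzero, [w] would lie in [F], against the degree 2 of its minimal polynomial. *)
Lemma coord_inj0 x y : x%:K * w + y%:K = 0 -> x = 0 /\ y = 0.
Proof.
have [->|x0] := eqVneq x 0.
  by rewrite rmorph0 mul0r add0r => /eqP; rewrite fmorph_eq0 => /eqP.
move=> /eqP; rewrite addr_eq0 => /eqP e; exfalso.
have : w \in 1%AS.
  have -> : w = (- y / x)%:A.
    by rewrite -in_algE rmorphM rmorphN fmorphV -e mulrAC mulfV ?mul1r // fmorph_eq0.
  exact: rpredZ (mem1v _).
rewrite -adjoin_deg_eq1 -eqSS -size_minPoly minPoly_w size_map_poly.
rewrite -addrA size_polyDl size_polyXn //.
rewrite (leq_ltn_trans (size_polyD _ _)) // gtn_max.
rewrite (leq_ltn_trans (size_scale_leq _ _)) ?size_polyX //=.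
by rewrite (leq_ltn_trans (size_polyC_leq1 _)).
Qed.

Lemma coord_inj x y x' y' :
  x%:K * w + y%:K = x'%:K * w + y'%:K -> x = x' /\ y = y'.
Proof.
move=> e; have [|/subr0_eq -> /subr0_eq ->] // := @coord_inj0 (x - x') (y - y').
by rewrite !rmorphB mulrBl addrACA -opprD e subrr.
Qed.

Lemma coord_exists z : exists x y, z = x%:K * w + y%:K.
Proof.
have w0 : w != 0.
  apply: contra_neq (oner_neq0 F) => w0.
  by have [] := @coord_inj0 1 0; rewrite // rmorph0 w0 mulr0 addr0.
have disj : (<[w]> :&: 1 = 0)%VS.
  apply/eqP; rewrite -subv0; apply/subvP => u /memv_capP[/vlineP[x ->] /vlineP[y]].
  move=> e; rewrite memv0; have [|-> _] := @coord_inj0 x (- y); last by rewrite scale0r.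
  by rewrite mulr_algl e rmorphN subrr.
have : (<[w]> + 1 = {:K})%VS.
  apply/eqP; rewrite eqEdim subvf dimK dimv_disjoint_sum //.
  by rewrite dim_vline w0 dimv1.
move=> E; have /memv_addP[u /vlineP[x ->] [v /vlineP[y ->] ->]] : z \in (<[w]> + 1)%VS.
  by rewrite E memvf.
by exists x, y; rewrite mulr_algl.
Qed.

Lemma integers_scalar x : OK x%:K <-> O x.
Proof. exact: integers_rmorph. Qed.

Lemma integers_coord x y : OK (x%:K * w + y%:K) <-> O x /\ O y.
Proof.
rewrite integersK; split=> [/latticeP[x' [y' [Ox Oy]]]|[Ox Oy]].
  by rewrite mulr1 => /coord_inj[-> ->].
by apply/latticeP; exists x, y; rewrite mulr1.
Qed.

Lemma integers_w : OK w.
Proof.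
have := (integers_coord 1 0).2; rewrite rmorph1 rmorph0 mul1r addr0.
by apply; split; [exact: integers1 | exact: integers0].
Qed.

Lemma denominators_K z : exists2 d, OK d /\ d != 0 & OK (d * z).
Proof.
have [x [y ->]] := coord_exists z.
have [d [Od d0] Odx] := denominators_numField x.
have [e [Oe e0] Oey] := denominators_numField y.
exists (d * e)%:K.
  by split; [apply/integers_scalar; exact: integersM | rewrite fmorph_eq0 mulf_neq0].
rewrite mulrDr mulrA -!rmorphM integers_coord.
by split; [rewrite mulrAC | rewrite -mulrA]; apply: integersM.
Qed.

(* [w - t] has norm [t^2 + b t + c], so [w - t] and [a] span an ideal. *)
Lemma intIdeal_lattice a t : O a -> a != 0 -> O t -> dvdO a (t ^+ 2 + b * t + c) ->
  intIdeal (lattice (w - t%:K) a%:K).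
Proof.
move=> Oa a0 Ot [k Ok ke].
have OL z : lattice (w - t%:K) a%:K z -> OK z.
  move=> /latticeP[x [y [Ox Oy ->]]].
  have -> : x%:K * (w - t%:K) + y%:K * a%:K = x%:K * w + (y * a - x * t)%:K.
    by ring.
  by apply/integers_coord; split=> //; apply: integersB; apply: integersM.
have LD z z' : lattice (w - t%:K) a%:K z -> lattice (w - t%:K) a%:K z' ->
    lattice (w - t%:K) a%:K (z + z').
  move=> /latticeP[x [y [Ox Oy ->]]] /latticeP[x' [y' [Ox' Oy' ->]]].
  apply/latticeP; exists (x + x'), (y + y').
  by split; [exact: integersD | exact: integersD | ring].
apply: intIdeal_of => //.
  exists a%:K; last by rewrite fmorph_eq0.
  apply/latticeP; exists 0, 1; split; [exact: integers0 | exact: integers1 |].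
  by rewrite rmorph0 rmorph1 mul0r add0r mul1r.
move=> u z; rewrite integersK => /latticeP[p [q [Op Oq ->]]] Lz.
rewrite mulr1 mulrDl; apply: LD; move: Lz => /latticeP[x [y [Ox Oy ->]]]; last first.
  apply/latticeP; exists (q * x), (q * y).
  by split; [exact: integersM | exact: integersM | ring].
(* These come from w (w - t) = - (b + t) (w - t) - k a and w a = a (w - t) + t a. *)
apply/latticeP; exists (p * (y * a - x * (b + t))), (p * (y * t - x * k)).
split; [apply: integersM => //|apply: integersM => //|].
- by apply: integersB; apply: integersM => //; apply: integersD.
- by apply: integersB; apply: integersM.
have ke' : t%:K ^+ 2 + b%:K * t%:K + c%:K = k%:K * a%:K.
  by rewrite -rmorphXn -!rmorphM -!rmorphD ke.
have we := sqr_w.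
transitivity (p%:K * (x%:K * (w ^+ 2 - t%:K * w) + y%:K * a%:K * w)); first by ring.
rewrite we.
transitivity (p%:K * ((y%:K * a%:K - x%:K * (b%:K + t%:K)) * (w - t%:K) +
   y%:K * t%:K * a%:K - x%:K * (k%:K * a%:K))); last by ring.
by rewrite -ke'; ring.
Qed.

(** [w - t] is a root of X^2 + (b + 2 t) X + k a. If [g] divides the three elements, (w - t) / g is
    still integral; its [w]-coordinate is 1 / g, so [g] is a unit. *)
Lemma lattice_primitive a t k : O a -> a != 0 -> O t -> O k ->
  t ^+ 2 + b * t + c = k * a -> gcd_one [:: a; b + 2%:R * t; k].
Proof.
move=> Oa a0 Ot Ok ke g Og dg.
have [a1 Oa1 ae] : dvdO g a by apply: dg; rewrite !inE eqxx.
have [b1 Ob1 be] : dvdO g (b + 2%:R * t) by apply: dg; rewrite !inE eqxx orbT.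
have [k1 Ok1 kge] : dvdO g k by apply: dg; rewrite !inE eqxx !orbT.
have g0 : g != 0 by apply: contra_neq a0 => g0; rewrite ae g0 mulr0.
have gK0 : g%:K != 0 by rewrite fmorph_eq0.
have : OK ((w - t%:K) / g%:K).
  apply: (@integers_quadratic _ _ b1%:K (k1 * a1)%:K).
  - exact/integers_scalar.
  - by apply/integers_scalar; apply: integersM.
  apply: (mulfI (mulf_neq0 gK0 gK0)); rewrite mulr0.
  transitivity (w ^+ 2 - (t *+ 2)%:K * w + t%:K ^+ 2 + (b1 * g)%:K * (w - t%:K)
     + ((k1 * g) * (a1 * g))%:K); first by field.
  by rewrite -be -kge -ae -ke sqr_w; ring.
have -> : (w - t%:K) / g%:K = (g^-1)%:K * w + (- t / g)%:K by field.
by move=> /integers_coord[Og1 _].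
Qed.

Lemma mem_lattice_l (z1 z2 : K) : lattice z1 z2 z1.
Proof.
apply/latticeP; exists 1, 0; rewrite rmorph1 rmorph0 mul1r mul0r addr0.
by split; [exact: integers1 | exact: integers0 |].
Qed.

Lemma mem_lattice_r (z1 z2 : K) : lattice z1 z2 z2.
Proof.
apply/latticeP; exists 0, 1; rewrite rmorph1 rmorph0 mul1r mul0r add0r.
by split; [exact: integers0 | exact: integers1 |].
Qed.

(* The second factor is the conjugate of the first, as [- b - w] is the
   conjugate of [w]. *)
Lemma mul_lattice_conj a t : O a -> a != 0 -> O t ->
  dvdO a (t ^+ 2 + b * t + c) ->
  mulIdeal (lattice (w - t%:K) a%:K) (lattice (w - (- b - t)%:K) a%:K) =
  principal a%:K.
Proof.
move=> Oa a0 Ot dk; have [k Ok ke] := dk.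
have [x [y [r [Ox Oy Or bez]]]] : exists x y r,
    [/\ O x, O y, O r & x * a + y * (b + 2%:R * t) + r * k = 1].
  apply: gcd_one_bezout3 => //; last exact: lattice_primitive.
  by apply: integersD => //; apply: integersM => //; apply: integers_nat.
have [fM _] := intIdeal_lattice Oa a0 Ot dk.
have [fM' _] : intIdeal (lattice (w - (- b - t)%:K) a%:K).
  apply: intIdeal_lattice => //; first by do 2?apply: integersB; rewrite ?sub0r//;
    apply: integersN.
  by exists k => //; rewrite -ke; ring.
have [fa _] : intIdeal (principal a%:K).
  by apply: intIdeal_principal; [apply/integers_scalar | rewrite fmorph_eq0].
have kK : t%:K ^+ 2 + b%:K * t%:K + c%:K = k%:K * a%:K by rewrite -[RHS]rmorphM -ke;
  ring.
apply/seteqP; split; last first.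
  move=> _ [u Ou <-]; apply: fracIdealM => //; first exact: fracIdeal_mul.
  (* The three bracketed elements of the product equal a a, a (b + 2 t) and - k a, so the Bezout
     relation [bez] combines them into [a]. *)
  pose z := x%:K * (a%:K * a%:K)
    + y%:K * (a%:K * (w - (- b - t)%:K) - (w - t%:K) * a%:K)
    + (- r)%:K * ((w - t%:K) * (w - (- b - t)%:K)).
  have ze : z = a%:K.
    rewrite /z; apply/esym; transitivity ((x * a + y * (b + 2%:R * t) + r * k)%:K *
      a%:K).
      by rewrite bez rmorph1 mul1r.
    transitivity (x%:K * (a%:K * a%:K) + y%:K * (b%:K + 2%:R * t%:K) * a%:K
      + r%:K * (k%:K * a%:K)); first by ring.
    rewrite -kK.
    transitivity (x%:K * (a%:K * a%:K) + y%:K * (b%:K + 2%:R * t%:K) * a%:K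
      + (- r)%:K * (w ^+ 2 + b%:K * w - b%:K * t%:K - t%:K ^+ 2)); last by ring.
    by rewrite sqr_w; ring.
  have fMM' := fracIdeal_mul fM fM'.
  have mM := mem_lattice_l; have mM' := mem_lattice_r.
  rewrite -[X in _ X]ze; apply: (fracIdealD fMM'); first apply: (fracIdealD fMM').
  - by apply: fracIdealM => //; [exact/integers_scalar | apply: mem_mulIdeal].
  - apply: fracIdealM => //; first exact/integers_scalar.
    by apply: fracIdealB => //; apply: mem_mulIdeal.
  - apply: fracIdealM => //; first by apply/integers_scalar/integersN.
    exact: mem_mulIdeal.
apply: mulIdeal_min; [exact: fracIdeal0 | by move=> ? ?; apply: fracIdealD |].
have OKw := integers_w; have OKt : OK t%:K by apply/integers_scalar.
have OKa : OK a%:K by apply/integers_scalar.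
have OKbt : OK (- b - t)%:K.
  by apply/integers_scalar; apply: integersB => //; apply: integersN.
move=> _ _ /latticeP[p [q [Op Oq ->]]] /latticeP[p' [q' [Op' Oq' ->]]].
have [/integers_scalar OKp /integers_scalar OKq] := (Op, Oq).
have [/integers_scalar OKp' /integers_scalar OKq'] := (Op', Oq').
have OKk : OK k%:K by apply/integers_scalar.
exists (- (p%:K * p'%:K * k%:K) + p%:K * q'%:K * (w - t%:K)
        + q%:K * p'%:K * (w - (- b - t)%:K) + q%:K * q'%:K * a%:K).
  do !apply: integersD; do ?[apply: integersN]; do ?[apply: integersM => //];
    exact: integersB.
transitivity (- (p%:K * p'%:K * (k%:K * a%:K)) + p%:K * q'%:K * (w - t%:K) * a%:K
        + q%:K * p'%:K * (w - (- b - t)%:K) * a%:K + q%:K * q'%:K * a%:K * a%:K);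
          first by ring.
rewrite -kK.
transitivity (p%:K * p'%:K * (w ^+ 2 + b%:K * w - b%:K * t%:K - t%:K ^+ 2)
  + p%:K * q'%:K * (w - t%:K) * a%:K
  + q%:K * p'%:K * (w - (- b - t)%:K) * a%:K + q%:K * q'%:K * a%:K * a%:K);
    last by ring.
by rewrite sqr_w; ring.
Qed.

(** [z'] is the conjugate of [z] and [n] is its norm. *)
Lemma norm_exists z : OK z -> z != 0 ->
  exists z' n, [/\ OK z', n != 0 & n%:K = z' * z].
Proof.
have [p [q ->]] := coord_exists z; rewrite integers_coord => -[Op Oq] z0.
exists ((- p)%:K * w + (q - b * p)%:K), (q ^+ 2 - b * p * q + c * p ^+ 2).
have e : (q ^+ 2 - b * p * q + c * p ^+ 2)%:K =
    ((- p)%:K * w + (q - b * p)%:K) * (p%:K * w + q%:K).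
  transitivity (- p%:K ^+ 2 * w ^+ 2 + (q - b * p)%:K * (p%:K * w + q%:K)
    - p%:K * w * q%:K); last by ring.
  by rewrite sqr_w; ring.
split=> //.
  apply/integers_coord; split; first exact: integersN.
  by apply: integersB => //; apply: integersM.
apply: contra_neq z0 => n0; move: e; rewrite n0 rmorph0 => /esym/eqP.
rewrite mulf_eq0 => /orP[/eqP/coord_inj0[/eqP]|/eqP//].
by rewrite oppr_eq0 => /eqP-> /eqP; rewrite mulr0 subr0 => /eqP->; rewrite !rmorph0;
  ring.
Qed.

(** A basis in triangular form: [A] collects the [w]-coordinates of [I], and [B] is its intersection
    with [F]. Both are principal, so [I] is spanned by some u w + s and v; stability under [w] makes
    [u] divide both [v] and [s]. *)
Lemma fracIdeal_lattice I : fracIdeal I -> exists u a t,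
  [/\ u != 0, O a /\ a != 0, O t, dvdO a (t ^+ 2 + b * t + c)
    & I = mulIdeal (principal u%:K) (lattice (w - t%:K) a%:K)].
Proof.
move=> fI; have [[z Iz z0] _ _ [d [Od d0 dI]]] := fI.
pose A := [set x | exists y, I (x%:K * w + y%:K)]; pose B := [set y | I y%:K].
have [m [m0 Om mI]] : exists m, [/\ m != 0, O m & forall v, I v -> OK (m%:K * v)].
  have [d' [m [Od' m0 me]]] := norm_exists Od d0; exists m; split=> // [|v Iv].
    by apply/integers_scalar; rewrite me; apply: integersM.
  by rewrite me -mulrA; apply: integersM => //; apply: dI.
have [n n0 Bn] : exists2 n, n != 0 & B n.
  have [|n' [n [On' n0 ne]]] := @norm_exists (d * z) (dI _ Iz).
    by rewrite mulf_neq0.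
  by exists n => //; rewrite /B /mkset ne mulrA; apply: fracIdealM => //;
    apply: integersM.
have IK x v : O x -> I v -> I (x%:K * v).
  by move=> Ox Iv; apply: fracIdealM => //; apply/integers_scalar.
have fA : fracIdeal A.
  split.
  - exists n => //; exists 0; rewrite rmorph0 addr0 mulrC.
    by apply: fracIdealM => //; apply: integers_w.
  - move=> x x' [y Ixy] [y' Ixy']; exists (y + y').
    suff -> : (x + x')%:K * w + (y + y')%:K = (x%:K * w + y%:K) + (x'%:K * w + y'%:K).
      exact: fracIdealD.
    by ring.
  - move=> e x Oe [y Ixy]; exists (e * y).
    suff -> : (e * x)%:K * w + (e * y)%:K = e%:K * (x%:K * w + y%:K) by apply: IK.
    by ring.
  - exists m; split=> // x [y /mI].
    have -> : m%:K * (x%:K * w + y%:K) = (m * x)%:K * w + (m * y)%:K by ring.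
    by move=> /integers_coord[].
have fB : fracIdeal B.
  split; first by exists n.
  - by move=> x y; rewrite /B /mkset => Ix Iy; rewrite rmorphD; apply: fracIdealD.
  - by move=> e x Oe; rewrite /B /mkset => Ix; rewrite rmorphM; apply: IK.
  - by exists m; split=> // x /mI; rewrite -rmorphM => /integers_scalar.
have [u u0 AE] := pid fA; have [v v0 BE] := pid fB.
have [s Is] : A u by rewrite AE; apply: mem_principal.
have Bv : B v by rewrite BE; apply: mem_principal.
(* [w * v] is in [I] and has [w]-coordinate [v]. *)
have [a Oa ave] : principal u v.
  by rewrite -AE; exists 0; rewrite rmorph0 addr0 mulrC; apply: fracIdealM => //;
    apply: integers_w.
(* This is the [w]-coordinate of w (u w + s). *)
have [t Ot te] : principal u (s - u * b).
  rewrite -AE; exists (- u * c).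
  have -> : (s - u * b)%:K * w + (- u * c)%:K = w * (u%:K * w + s%:K).
    transitivity (u%:K * w ^+ 2 + s%:K * w); last by ring.
    by rewrite sqr_w; ring.
  by apply: fracIdealM => //; apply: integers_w.
have se : s = - (- t - b) * u by rewrite mulNr mulrBl mulNr te; ring.
have {te} Ot : O (- t - b) by apply: integersB => //; apply: integersN.
set T := - t - b in se Ot; rewrite {}se in Is.
(* Multiplying u (w - T) by the conjugate of w - T gives [u] times the norm of w - T, an element of
   [B]. *)
have [k Ok ke] : principal v (u * (T ^+ 2 + b * T + c)).
  rewrite -BE /B /mkset.
  have -> : (u * (T ^+ 2 + b * T + c))%:K =
      (- (w + b%:K + T%:K)) * (u%:K * w + (- T * u)%:K).
    transitivity (- (u%:K * w ^+ 2 + (u * b)%:K * w - (T * u * (b + T))%:K));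
      last by ring.
    by rewrite sqr_w; ring.
  apply: fracIdealM => //; apply/integersN/integersD; last exact/integers_scalar.
  by apply: integersD => //; apply: integers_w.
have a0 : a != 0 by apply: contra_neq v0 => a0; rewrite -ave a0 mul0r.
have da : dvdO a (T ^+ 2 + b * T + c).
  by exists k => //; apply: (mulfI u0); rewrite -ke -ave; ring.
exists u, a, T; split=> //; have [fM _] := intIdeal_lattice Oa a0 Ot da.
rewrite mem_mul_principal //; apply/seteqP; split.
  move=> z' Iz'; have [x [y ze]] := coord_exists z'; rewrite ze in Iz' *.
  have [p Op pe] : principal u x by rewrite -AE; exists y.
  have [q Oq qe] : principal v (y + p * T * u).
    rewrite -BE /B /mkset.
    have -> : (y + p * T * u)%:K = (x%:K * w + y%:K) - p%:K * (u%:K * w + (- T * u)%:K).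
      by rewrite -pe; ring.
    by apply: fracIdealB => //; apply: IK.
  exists (p%:K * (w - T%:K) + q%:K * a%:K); first by apply/latticeP; exists p, q.
  have -> : y = q * (a * u) - p * T * u by rewrite ave qe; ring.
  by rewrite -pe; ring.
move=> _ [_ /latticeP[p [q [Op Oq ->]]] <-].
have -> : u%:K * (p%:K * (w - T%:K) + q%:K * a%:K) =
    p%:K * (u%:K * w + (- T * u)%:K) + q%:K * (a * u)%:K by ring.
by apply: fracIdealD => //; apply: IK => //; rewrite ave.
Qed.

Lemma fracIdeal_principal_K z : z != 0 -> fracIdeal (principal z).
Proof.
by move=> z0; have [d [Od d0] Odz] := denominators_K z; apply: fracIdeal_principal Odz.
Qed.

Lemma invertibleIdeals_K : invertibleIdeals K.
Proof.
move=> I fI; have [u [a [t [u0 [Oa a0] Ot da ->]]]] := fracIdeal_lattice fI.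
have n0 : (u * a)^-1%:K != 0 by rewrite fmorph_eq0 invr_eq0 mulf_neq0.
have [fM' _] : intIdeal (lattice (w - (- b - t)%:K) a%:K).
  apply: intIdeal_lattice => //; first by apply: integersB => //; apply: integersN.
  by case: da => k Ok ke; exists k => //; rewrite -ke; ring.
exists (mulIdeal (principal (u * a)^-1%:K) (lattice (w - (- b - t)%:K) a%:K)).
  by apply: fracIdeal_mul => //; apply: fracIdeal_principal_K.
rewrite mulIdealACA mul_lattice_conj // !principalM -!rmorphM.
by rewrite invfM mulrA mulfV // mul1r mulVf // rmorph1 principal1.
Qed.

End QuadraticLattices.

(** * Positive elements and the congruence group *)

Section Congruence.

Variables (R : realType) (F : fieldExtType rat) (K : fieldExtType F).
Variable iota : {rmorphism K -> R[i]}.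
Implicit Types (x y : F) (g h : 'M[F]_2) (Q : bqForm F).

Local Notation O := (ringOfIntegers F).

Lemma iota_algM x y : iota (x * y)%:A = iota x%:A * iota y%:A.
Proof. exact: (rmorphM (iota \o in_alg K)). Qed.

Lemma positiveM x y : positive iota x -> positive iota y -> positive iota (x * y).
Proof. by rewrite /positive iota_algM; apply: mulr_gt0. Qed.

Lemma positiveD x y : positive iota x -> positive iota y -> positive iota (x + y).
Proof. by rewrite /positive scalerDl rmorphD; apply: addr_gt0. Qed.

Lemma positive1 : positive iota 1.
Proof. by rewrite /positive scale1r rmorph1 ltr01. Qed.

Lemma positive_neq0 x : positive iota x -> x != 0.
Proof.
by move=> px; apply/eqP => x0; move: px; rewrite x0 /positive scale0r rmorph0 ltxx.
Qed.

Lemma positiveMr x y : positive iota x -> positive iota (x * y) -> positive iota y.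
Proof. by rewrite /positive iota_algM => x0; rewrite pmulr_rgt0. Qed.

Lemma positiveV x : positive iota x -> positive iota x^-1.
Proof.
move=> px; apply: (positiveMr px); rewrite mulfV; first exact: positive1.
exact: positive_neq0 px.
Qed.

Lemma positive_nat n : (0 < n)%N -> positive iota n%:R.
Proof.
case: n => // n _; elim: n => [|n IH]; first exact: positive1.
by rewrite -addn1 natrD; apply: positiveD => //; apply: positive1.
Qed.

Lemma det_mx2 (T : comNzRingType) (g : 'M[T]_2) :
  \det g = g 0 0 * g 1 1 - g 0 1 * g 1 0.
Proof.
rewrite (expand_det_row _ 0) big_ord_recl big_ord1 /cofactor !det_mx11 !mxE /=.
have -> : lift 0 0 = 1 :> 'I_2 by apply/val_inj.
have -> : lift 1 0 = 0 :> 'I_2 by apply/val_inj.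
by rewrite expr0 expr1; ring.
Qed.

Lemma mulmx2E (T : comNzRingType) (g h : 'M[T]_2) i j :
  (g *m h) i j = g i 0 * h 0 j + g i 1 * h 1 j.
Proof.
rewrite mxE big_ord_recl big_ord1.
by have -> : lift 0 0 = 1 :> 'I_2 by apply/val_inj.
Qed.

Lemma actForm1 Q : actForm Q 1%:M = Q.
Proof.
by case: Q => a b c; rewrite /actForm det1 !mxE /=; congr Form; rewrite invr1; ring.
Qed.

Lemma actFormM Q g h : actForm Q (g *m h) = actForm (actForm Q g) h.
Proof.
rewrite /actForm det_mulmx invfM /= !mulmx2E; congr Form; ring.
Qed.

Lemma discForm_act Q g : \det g != 0 -> discForm (actForm Q g) = discForm Q.
Proof.
move=> d0; rewrite /discForm /actForm /=; apply: (mulfI d0); apply: (mulfI d0).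
move: d0; rewrite det_mx2 => d0; field.
by [].
Qed.

Variable N : nat.

Lemma Gamma1_1 : Gamma1 iota N 1%:M.
Proof.
split; rewrite ?det1.
- split=> [i j|]; last exact: unitO1.
  by rewrite mxE; apply: integers_nat.
- exact: positive1.
- by rewrite mxE; exists 0; rewrite ?mul0r //; apply: integers0.
- exists 1; first exact: unitO1.
  by rewrite mxE subrr; exists 0; rewrite ?mul0r //; apply: integers0.
Qed.

Lemma Gamma1M g h : Gamma1 iota N g -> Gamma1 iota N h -> Gamma1 iota N (g *m h).
Proof.
move=> [[Og ug] pg dg [u uu du]] [[Oh uh] ph dh [v uv dv]]; split.
- split=> [i j|]; last by rewrite det_mulmx; apply: unitOM.
  by rewrite mulmx2E; apply: integersD; apply: integersM.
- by rewrite det_mulmx; apply: positiveM.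
- rewrite mulmx2E; apply: dvdOD; last exact: dvdO_mull.
  by rewrite mulrC; apply: dvdO_mull.
- exists (u * v); first exact: unitOM.
  have -> : (g *m h) 1 1 - u * v = h 0 1 * g 1 0 + (h 1 1 * (g 1 1 - u) + u * (h 1 1
    - v)).
    by rewrite mulmx2E; ring.
  have [_ Ou _] := uu.
  apply: dvdOD; first exact: dvdO_mull.
  by apply: dvdOD; apply: dvdO_mull.
Qed.

Lemma Gamma1V g : Gamma1 iota N g -> exists2 h, Gamma1 iota N h & g *m h = 1%:M.
Proof.
move=> [[Og ug] pg dg [u uu du]]; have [d0 Od Odi] := ug; have [u0 Ou Oui] := uu.
have gu : g \in unitmx by rewrite unitmxE unitfE.
have iE i j : invmx g i j = (\det g)^-1 * \adj g i j by rewrite /invmx gu mxE.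
have a00 : \adj g 0 0 = g 1 1.
  rewrite mxE /cofactor det_mx11 !mxE expr0 mul1r.
  by congr (g _ _); apply/val_inj.
have a01 : \adj g 0 1 = - g 0 1.
  rewrite mxE /cofactor det_mx11 !mxE expr1 mulN1r.
  by congr (- g _ _); apply/val_inj.
have a10 : \adj g 1 0 = - g 1 0.
  rewrite mxE /cofactor det_mx11 !mxE expr1 mulN1r.
  by congr (- g _ _); apply/val_inj.
have a11 : \adj g 1 1 = g 0 0.
  rewrite mxE /cofactor det_mx11 !mxE sqrrN expr1n mul1r.
  by congr (g _ _); apply/val_inj.
have ord2 (i : 'I_2) : i = 0 \/ i = 1.
  by case: i => -[|[|//]] ?; [left|right]; apply/val_inj.
exists (invmx g); last exact: mulmxV.
split; rewrite ?det_inv.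
- split=> [i j|]; last exact: unitOV.
  rewrite iE; apply: integersM => //.
  by case: (ord2 i) => ->; case: (ord2 j) => ->;
    rewrite ?a00 ?a01 ?a10 ?a11 //; apply: integersN.
- exact: positiveV.
- rewrite iE a10; apply: dvdO_mull => //; rewrite -mulN1r.
  by apply: dvdO_mull => //; apply: integersN.
(* Modulo [N] the determinant is [g 0 0 * u], so the lower right entry [g 0 0 / \det g] of the
   inverse is [u^-1]. *)
- exists u^-1; first exact: unitOV.
  have -> : invmx g 1 1 - u^-1 =
      (\det g)^-1 * (u^-1 * (- g 0 0 * (g 1 1 - u) + g 0 1 * g 1 0)).
    rewrite iE a11; apply: (mulfI d0); move: d0; rewrite det_mx2 => d0.
    by field; rewrite u0.
  apply/dvdO_mull/dvdO_mull => //; apply: dvdOD; last exact: dvdO_mull.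
  by apply: dvdO_mull => //; apply: integersN.
Qed.

Lemma formClass_refl Q : formClass iota N Q Q.
Proof. by exists 1%:M; [apply: Gamma1_1 | rewrite actForm1]. Qed.

Lemma formClass_act Q g : Gamma1 iota N g ->
  formClass iota N (actForm Q g) = formClass iota N Q.
Proof.
move=> Gg; apply/seteqP; split=> _ [h Gh <-].
  by exists (g *m h); [apply: Gamma1M | rewrite actFormM].
have [k Gk gk] := Gamma1V Gg; exists (k *m h); first exact: Gamma1M.
by rewrite -actFormM mulmxA gk mul1mx.
Qed.

End Congruence.

(** * Forms and their roots *)

Section FormClassMap.

Variables (R : realType) (F : fieldExtType rat) (K : fieldExtType F).
Variable iota : {rmorphism K -> R[i]}.
Variables (w : K) (b c : F) (N : nat).

Local Notation O := (ringOfIntegers F).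
Local Notation OK := (ringOfIntegers K).
Local Notation "x %:K" := (in_alg K x) (at level 2, format "x %:K").
Local Notation d := (b ^+ 2 - 4%:R * c).
Implicit Types (a t x y : F) (z : K) (I : set K) (Q : bqForm F).

Hypothesis pid : classNumberOne F.
Hypothesis real_F : forall x, iota x%:A \is Num.real.
Hypothesis dimK : \dim {:K} = 2%N.
Hypothesis w_upper : upperHalf iota w.
Hypothesis integersK : OK = lattice w 1.
Hypothesis Ob : O b.
Hypothesis minPoly_w :
  minPoly 1%AS w = map_poly (in_alg K) ('X^2 + b *: 'X + c%:P).
Hypothesis N_gt0 : (0 < N)%N.

Let w2 : w ^+ 2 = - b%:K * w - c%:K := sqr_w minPoly_w.
Let coordI := coord_inj minPoly_w.
Let coordX := coord_exists dimK minPoly_w.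
Let intC := integers_coord integersK minPoly_w.
Let intS := @integers_scalar F K.
Let invK := invertibleIdeals_K pid dimK integersK Ob minPoly_w.
Let denK := denominators_K dimK integersK minPoly_w.

Let NK_neq0 : N%:R != 0 :> K.
Proof. by rewrite -[N%:R](rmorph_nat (in_alg K)) fmorph_eq0 natr_neq0_numField. Qed.

Let two_neq0 : 2%:R != 0 :> F. Proof. exact: natr_neq0_numField. Qed.

Let posP x := @positive_neq0 R F K iota x.

(** * Positivity and the upper half-plane *)

(** [iota] is real on [F], so the imaginary part of the image is that of [w] times the image of
    [x]. *)
Lemma upperHalf_coord x y : upperHalf iota (x%:K * w + y%:K) <-> positive iota x.
Proof.
move: w_upper (real_F x) (real_F y).
rewrite /upperHalf /positive /mkset rmorphD rmorphM /=.
case: (iota w) => rw iw; case: (iota x%:A) => rx ix; case: (iota y%:A) => ry iy.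
rewrite !complex_real /= => w0 /eqP-> /eqP->.
by rewrite mul0r addr0 addr0 ltcE /= eqxx /= pmulr_lgt0.
Qed.

Lemma positive_or_neg x : x != 0 -> positive iota x \/ positive iota (- x).
Proof.
move=> x0; have := real_ltgtP (real_F x) (real0 _).
have : iota x%:A != 0 by rewrite fmorph_eq0 -in_algE fmorph_eq0.
rewrite /positive scaleNr rmorphN oppr_gt0 => ne h.
by case: h ne => [?|?|_ //]; [right | left].
Qed.

Lemma positive_sqr x : x != 0 -> positive iota (x ^+ 2).
Proof.
by case/positive_or_neg => px; [|rewrite -sqrrN]; rewrite expr2; apply: positiveM.
Qed.

(** [d] is the square of 2 w + b, which lies in the upper half-plane. As the square is real, the
    image of 2 w + b is purely imaginary. *)
Lemma disc_neg : positive iota (- d).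
Proof.
have e : (- d)%:K = - (2%:R * w + b%:K) ^+ 2.
  transitivity (- (4%:R * w ^+ 2 + 4%:R * b%:K * w + b%:K ^+ 2)); last by ring.
  by rewrite w2; ring.
set u := 2%:R * w + b%:K in e.
have : upperHalf iota u.
  by rewrite /u -[2%:R in X in upperHalf _ X](rmorph_nat (in_alg K));
    apply/upperHalf_coord/positive_nat.
have := real_F (- d); rewrite /positive /upperHalf /mkset.
rewrite -[(- d)%:A]/((- d)%:K) e rmorphN rmorphXn /=.
case: (iota u) => r s /=.
rewrite expr2 /= complex_real => /eqP rs s0.
have r0 : r = 0.
  have : r * s = 0 by move: rs; rewrite [s * r]mulrC => /eqP;
    rewrite oppr_eq0 -mulr2n mulrn_eq0 => /eqP.
  by move=> /eqP; rewrite mulf_eq0 [s == 0]gt_eqF // orbF => /eqP.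
by rewrite ltcE /= rs eqxx /= r0 mul0r sub0r opprK mulr_gt0.
Qed.

Lemma positive_evalForm Q x y : positive iota (fa Q) -> discForm Q = d ->
  (x != 0) || (y != 0) ->
  positive iota (fa Q * x ^+ 2 + fb Q * x * y + fc Q * y ^+ 2).
Proof.
move=> pA dQ xy; have p4 := positive_nat iota (ltn0Sn 3).
apply: (positiveMr (positiveM p4 pA)).
have -> : 4%:R * fa Q * (fa Q * x ^+ 2 + fb Q * x * y + fc Q * y ^+ 2) =
    (2%:R * fa Q * x + fb Q * y) ^+ 2 + (- d) * y ^+ 2.
  by rewrite -dQ /discForm; ring.
have [y0|y0] := eqVneq y 0.
  rewrite y0 eqxx orbF in xy *.
  rewrite mulr0 addr0 expr0n mulr0 addr0; apply: positive_sqr.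
  by rewrite !mulf_neq0 // posP.
have p2 := positiveM disc_neg (positive_sqr y0).
have [->|s0] := eqVneq (2%:R * fa Q * x + fb Q * y) 0.
  by rewrite expr0n add0r.
by apply: positiveD => //; apply: positive_sqr.
Qed.

(** * The root of a form in terms of [w] *)

(* The root of [Q] in the upper half-plane is [(w - formShift Q) / fa Q]. *)
Definition formShift Q : F := (fb Q - b) / 2%:R.

Lemma fb_shift Q : fb Q = b + 2%:R * formShift Q.
Proof. by rewrite /formShift; field. Qed.

Lemma fc_shift Q : discForm Q = d ->
  formShift Q ^+ 2 + b * formShift Q + c = fc Q * fa Q.
Proof.
move=> dQ; have n4 : 4%:R != 0 :> F by exact: natr_neq0_numField.
apply: (mulfI n4); transitivity ((b + 2%:R * formShift Q) ^+ 2 - d); first by ring.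
by rewrite -fb_shift -dQ /discForm; ring.
Qed.

Local Notation rootOf Q := ((w - (formShift Q)%:K) / (fa Q)%:K).

Lemma rootOf_root Q : fa Q != 0 -> discForm Q = d ->
  (fa Q)%:K * rootOf Q ^+ 2 + (fb Q)%:K * rootOf Q + (fc Q)%:K = 0.
Proof.
move=> A0 dQ; have AK0 : (fa Q)%:K != 0 by rewrite fmorph_eq0.
apply: (mulfI AK0); rewrite mulr0 fb_shift.
transitivity (w ^+ 2 + b%:K * w - (formShift Q ^+ 2 + b * formShift Q)%:K
   + (fc Q * fa Q)%:K); first by field.
by rewrite -fc_shift // w2; ring.
Qed.

Lemma rootOf_coord Q : fa Q != 0 ->
  rootOf Q = (fa Q)^-1%:K * w + (- formShift Q / fa Q)%:K.
Proof. by move=> A0; field; rewrite fmorph_eq0. Qed.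

Lemma rootOf_upper Q : positive iota (fa Q) -> upperHalf iota (rootOf Q).
Proof.
move=> pA; rewrite rootOf_coord; last exact: posP.
by apply/upperHalf_coord/positiveV.
Qed.

(** (2 a z + b_Q)^2 = d = (2 w + b)^2 leaves two signs. The negative one would give 2 a x = - 2 for
    the [w]-coordinate x > 0 of [z]. *)
Lemma rootOf_unique Q z : positive iota (fa Q) -> discForm Q = d ->
  upperHalf iota z -> (fa Q)%:K * z ^+ 2 + (fb Q)%:K * z + (fc Q)%:K = 0 ->
  z = rootOf Q.
Proof.
move=> pA dQ; have [x [y ->]] := coordX z => /upperHalf_coord px e.
have A0 := posP pA; have AK0 : (fa Q)%:K != 0 by rewrite fmorph_eq0.
have : (2%:R * (fa Q)%:K * (x%:K * w + y%:K) + (fb Q)%:K) ^+ 2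
    = (2%:R * w + b%:K) ^+ 2.
  transitivity (4%:R * (fa Q)%:K * 0 + d%:K).
    by rewrite -e -dQ /discForm; ring.
  transitivity (4%:R * w ^+ 2 + 4%:R * b%:K * w + b%:K ^+ 2); last by ring.
  by rewrite w2; ring.
have twoK : 2%:R != 0 :> K by rewrite -[2%:R](rmorph_nat (in_alg K)) fmorph_eq0.
move=> /eqP; rewrite eqf_sqr => /orP[/eqP e1|/eqP e1].
  apply: (mulfI AK0); apply: (mulfI twoK); apply: (addIr (fb Q)%:K).
  by rewrite mulrA e1 fb_shift; field.
have [e2 _] : 2%:R * fa Q * x = - 2%:R /\ 2%:R * fa Q * y + fb Q = - b.
  apply: coordI; rewrite -[RHS]/((- 2%:R)%:K * w + (- b)%:K).
  by move: e1; set u := _ + _; move=> e1; transitivity u; [rewrite /u | rewrite e1];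
    ring.
have /posP := positiveD (positiveM (positiveM (positive_nat iota (ltn0Sn 1)) pA) px)
  (positive_nat iota (ltn0Sn 1)).
by rewrite e2 addNr eqxx.
Qed.

Lemma rootFormE Q : positive iota (fa Q) -> discForm Q = d ->
  rootForm iota Q = rootOf Q.
Proof.
move=> pA dQ.
have E z : fa Q *: z ^+ 2 + fb Q *: z + (fc Q)%:A =
    (fa Q)%:K * z ^+ 2 + (fb Q)%:K * z + (fc Q)%:K.
  by rewrite -[fa Q *: _]mulr_algl -[fb Q *: _]mulr_algl.
apply: xget_unique; last first.
  by move=> z [uz e]; apply: rootOf_unique => //; rewrite -E.
by split; [exact: rootOf_upper | rewrite E rootOf_root // posP].
Qed.

(** The division by 2 is harmless: with t the shift, w - t is a root of X^2 + b_Q X + a c_Q, hence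
    integral, and so is its coordinate. *)
Lemma formShift_int Q : O (fa Q) -> O (fb Q) -> O (fc Q) -> fa Q != 0 ->
  discForm Q = d -> O (formShift Q).
Proof.
move=> OA OB OC A0 dQ.
have : OK (w - (formShift Q)%:K).
  apply: (@integers_quadratic _ _ (fb Q)%:K (fc Q * fa Q)%:K).
  - exact/intS.
  - by apply/intS/integersM.
  - by rewrite -fc_shift // fb_shift; transitivity (w ^+ 2 + b%:K * w + c%:K);
    [ring | rewrite w2; ring].
have -> : w - (formShift Q)%:K = 1%:K * w + (- formShift Q)%:K by ring.
by move=> /intC[_ /integersN]; rewrite opprK.
Qed.

(** * The lattice of a form *)

Lemma lattice_scale (u z1 z2 : K) :
  lattice (u * z1) (u * z2) = [set u * z | z in lattice z1 z2].
Proof.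
apply/seteqP; split=> [z /latticeP[x [y [Ox Oy ->]]]|_ [z /latticeP[x [y [Ox Oy ->]]]
  <-]].
  by exists (x%:K * z1 + y%:K * z2); [apply/latticeP; exists x, y | ring].
by apply/latticeP; exists x, y; split=> //; ring.
Qed.

Lemma lattice_GL2 (g : 'M[F]_2) (z1 z2 : K) : (forall i j, O (g i j)) ->
  unitO (\det g) ->
  lattice ((g 0 0)%:K * z1 + (g 0 1)%:K * z2) ((g 1 0)%:K * z1 + (g 1 1)%:K * z2) =
  lattice z1 z2.
Proof.
move=> Og [g0 Odet Odet1]; apply/seteqP; split=> z /latticeP[x [y [Ox Oy ->]]].
  apply/latticeP; exists (x * g 0 0 + y * g 1 0), (x * g 0 1 + y * g 1 1).
  by split; [| | ring]; apply: integersD; apply: integersM.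
apply/latticeP; exists ((\det g)^-1 * (x * g 1 1 - y * g 1 0)),
  ((\det g)^-1 * (y * g 0 0 - x * g 0 1)).
split; [| |]; try by apply: integersM => //; apply: integersB; apply: integersM.
rewrite det_mx2 in g0 *.
have gK0 : (g 0 0)%:K * (g 1 1)%:K - (g 0 1)%:K * (g 1 0)%:K != 0.
  by rewrite -!rmorphM -rmorphB fmorph_eq0.
by field.
Qed.

Lemma congOne_scalar x : congOne N x -> congOne N x%:K.
Proof.
move=> [Ox x0 [q Oq e]]; split; [exact/intS | by rewrite fmorph_eq0 |].
exists q%:K; first exact/intS.
by rewrite -(rmorph_nat (in_alg K)) -rmorphM -e rmorphB rmorph1.
Qed.

Lemma formsP Q : forms iota N d Q ->
  [/\ positive iota (fa Q), discForm Q = d, O (fa Q), O (formShift Q)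
    & comaximal (fa Q) N%:R].
Proof.
move=> [[OA OB OC] _ pA dQ cA]; have A0 := posP pA.
split=> //; first exact: formShift_int.
by apply: gcd_one_comaximal => //; apply: integers_nat.
Qed.

Lemma lattice_rootOf Q : fa Q != 0 ->
  lattice (rootOf Q) 1 =
  [set (fa Q)^-1%:K * z | z in lattice (w - (formShift Q)%:K) (fa Q)%:K].
Proof.
move=> A0; rewrite -lattice_scale; congr (lattice _ _).
  by rewrite fmorphV mulrC.
by rewrite -rmorphM mulVf // rmorph1.
Qed.

Lemma intIdeal_form Q : forms iota N d Q ->
  intIdeal (lattice (w - (formShift Q)%:K) (fa Q)%:K).
Proof.
move=> fQ; have [pA dQ OA Ot _] := formsP fQ; have [[_ _ OC] _ _ _ _] := fQ.
apply: (intIdeal_lattice integersK Ob minPoly_w) => //; first exact: posP.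
by exists (fc Q) => //; rewrite fc_shift.
Qed.

Lemma fracIdeal_form Q : forms iota N d Q -> fracIdeal (lattice (rootOf Q) 1).
Proof.
move=> fQ; have [pA _ _ _ _] := formsP fQ; have A0 := posP pA.
have [fM _] := intIdeal_form fQ.
rewrite lattice_rootOf // -mem_mul_principal //; apply: fracIdeal_mul => //.
by apply: (fracIdeal_principal_neq0 denK); rewrite fmorph_eq0 invr_eq0.
Qed.

Lemma form_congOne Q : forms iota N d Q ->
  exists2 x, O x & congOne N (x * fa Q).
Proof.
move=> fQ; have [pA _ OA _ cA] := formsP fQ.
by apply: comaximal_congOne => //; apply: posP.
Qed.

Lemma form_idealsPrimeTo Q : forms iota N d Q ->
  idealsPrimeTo N (lattice (rootOf Q) 1).
Proof.
move=> fQ; have [pA _ OA Ot _] := formsP fQ; have A0 := posP pA.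
have AK0 : (fa Q)%:K != 0 by rewrite fmorph_eq0.
have [x Ox /congOne_scalar cx] := form_congOne fQ.
apply/(idealsPrimeToP invK NK_neq0); first exact: fracIdeal_form.
(* One element plays both parts: it clears the denominator [fa Q] of the lattice, and the quotient
   is 1, a member of the lattice. *)
exists (x * fa Q)%:K, (x * fa Q)%:K; split=> //.
  rewrite lattice_rootOf // => _ [z Mz <-].
  have [_ MO] := intIdeal_form fQ.
  have -> : (x * fa Q)%:K * ((fa Q)^-1%:K * z) = x%:K * z by field.
  by apply: integersM; [apply/intS | apply: MO].
have [_ xA0 _] := cx; rewrite divff //; exact: mem_lattice_r.
Qed.

(** * Equivalent forms give the same ray class *)

(* The norm of [u - v z] for a root [z] of [Q] is [Q(u, v) / a]. *)
Lemma rootOf_moebius Q (g : 'M[F]_2) : positive iota (fa Q) -> discForm Q = d ->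
  \det g != 0 -> exists n r,
  [/\ positive iota n, (g 1 0)%:K * rootOf Q + (g 1 1)%:K != 0
    & ((g 0 0)%:K * rootOf Q + (g 0 1)%:K) / ((g 1 0)%:K * rootOf Q + (g 1 1)%:K)
      = (\det g * n)%:K * w + r%:K].
Proof.
move=> pA dQ g0; have A0 := posP pA.
set A := fa Q in pA A0 *; set B := fb Q; set C := fc Q; set z := rootOf Q.
set e := g 0 0; set f := g 0 1; set h := g 1 0; set k := g 1 1.
pose m := A * k ^+ 2 + B * k * (- h) + C * (- h) ^+ 2.
have pm : positive iota m.
  apply: positive_evalForm => //; rewrite oppr_eq0 -negb_and.
  apply: contra g0 => /andP[/eqP k0 /eqP h0].
  by rewrite det_mx2 -/e -/f -/h -/k k0 h0 !mulr0 subrr.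
have m0 := posP pm; have AK0 : A%:K != 0 by rewrite fmorph_eq0.
have mK0 : m%:K != 0 by rewrite fmorph_eq0.
have root : A%:K * z ^+ 2 + B%:K * z + C%:K = 0 by apply: rootOf_root.
(* The conjugate of h z + k, as the two roots of [Q] add up to - B / A. *)
pose v' := k%:K - h%:K * B%:K / A%:K - h%:K * z.
have norm : (h%:K * z + k%:K) * v' = (m / A)%:K.
  apply: (mulfI AK0); transitivity (m%:K - h%:K ^+ 2 * 0); last by field.
  by rewrite -root /v' /m; field.
have v0 : h%:K * z + k%:K != 0.
  apply: contraTneq (isT) => v0; move/eqP: norm; rewrite v0 mul0r eq_sym fmorph_eq0.
  by rewrite mulf_eq0 (negPf m0) invr_eq0 (negPf A0).
pose r := e * h * C / A + f * k - f * h * B / A.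
have num : (e%:K * z + f%:K) * v' = (\det g)%:K * z + r%:K.
  rewrite det_mx2 -/e -/f -/h -/k.
  apply: (mulfI AK0); transitivity (A%:K * ((e * k - f * h)%:K * z + r%:K) - e%:K *
    h%:K * 0); last by ring.
  by rewrite -root /v' /r; field.
(* [m^-1] is the [w]-coordinate 1 / A of [z] divided by the norm m / A of the denominator. *)
exists (m^-1), ((A / m) * (r - \det g * formShift Q / A)); split=> //.
  exact: positiveV.
have v'0 : v' != 0.
  apply: contraTneq (isT) => v0'; move/eqP: norm; rewrite v0' mulr0 eq_sym fmorph_eq0.
  by rewrite mulf_eq0 (negPf m0) invr_eq0 (negPf A0).
rewrite -(mulfK v'0 (e%:K * z + f%:K)) num.
transitivity (((\det g)%:K * z + r%:K) / ((h%:K * z + k%:K) * v')); first by field;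
  rewrite v'0.
rewrite norm /z; move: (\det g) => D; field.
by apply/andP; split.
Qed.

Lemma root_actForm Q g (u v z : K) : \det g != 0 ->
  u = (g 0 0)%:K * z + (g 0 1)%:K -> v = (g 1 0)%:K * z + (g 1 1)%:K ->
  (fa Q)%:K * u ^+ 2 + (fb Q)%:K * (u * v) + (fc Q)%:K * v ^+ 2 =
  (\det g)%:K * ((fa (actForm Q g))%:K * z ^+ 2
    + (fb (actForm Q g))%:K * z + (fc (actForm Q g))%:K).
Proof.
move=> g0 -> ->; have gK0 : (\det g)%:K != 0 by rewrite fmorph_eq0.
rewrite /actForm; cbn [fa fb fc].
by move: (\det g) gK0 => D D0; field.
Qed.

(** For the root z' of the transformed form, [g] maps z' to the root of [Q], so [z', 1] is the
    lattice of [Q] scaled by v = c_3 z' + c_4. Modulo [N] this [v] is the unit [s], up to the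
    denominator of z'. *)
Lemma rayClass_form_act Q g : forms iota N d Q -> forms iota N d (actForm Q g) ->
  Gamma1 iota N g ->
  rayClass N (lattice (rootOf Q) 1) = rayClass N (lattice (rootOf (actForm Q g)) 1).
Proof.
move=> fQ fQ' [[Og ug] pg [q Oq qe] [s us [r Or re]]].
have g0 := posP pg.
have [pA dQ OA Ot _] := formsP fQ; have [pA' dQ' OA' Ot' _] := formsP fQ'.
have A'0 := posP pA'; have A'K0 : (fa (actForm Q g))%:K != 0 by rewrite fmorph_eq0.
have [n [r' [pn v0 uv]]] := rootOf_moebius pA' dQ' g0.
have root' := rootOf_root A'0 dQ'.
have := @root_actForm Q g _ _ (rootOf (actForm Q g)) g0 erefl erefl.
rewrite root' mulr0.
set z' := rootOf (actForm Q g) in v0 uv root' *.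
set u := _ * z' + _ in uv *; set v := _ * z' + _ in v0 uv *; move=> uv0.
have uvE : u / v = rootOf Q.
  apply: rootOf_unique => //.
    by rewrite uv; apply/upperHalf_coord/positiveM.
  apply: (mulfI (mulf_neq0 v0 v0)); rewrite mulr0 -uv0; field.
  exact: v0.
have latE : lattice z' 1 = mulIdeal (lattice (rootOf Q) 1) (principal v).
  rewrite mulIdealC mem_mul_principal; last exact: fracIdeal_form.
  rewrite -lattice_scale -uvE mulrC divfK // mulr1 -(@lattice_GL2 g z' 1) //.
  by rewrite !mulr1.
have [f f'] := (fracIdeal_form fQ, fracIdeal_form fQ').
apply/(rayClassP invK denK NK_neq0 f f'); exists (principal v) => //.
have [x Ox /congOne_scalar cx] := form_congOne fQ'; have [s0 Os Osi] := us.
have [_ x0 _] := cx; have sK0 : s%:K != 0 by rewrite fmorph_eq0.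
have NE : N%:R = N%:R%:K :> K by rewrite rmorph_nat.
set A := fa (actForm Q g) in A'0 A'K0 cx x0 OA'.
(* Chosen so that x A + y N = x A (v / s), where x A = 1 (mod [N]) clears the denominator [A] of
   z'. *)
pose y := (s^-1 * x)%:K * (q%:K * (w - (formShift (actForm Q g))%:K) + (A * r)%:K).
have vE : (x * A)%:K + y * N%:R = (x * A)%:K * (s^-1%:K * v).
  rewrite /v qe (_ : g 1 1 = s + r * N%:R); last by rewrite -re addrC subrK.
  by rewrite /y /z' -/A NE; field; rewrite ?sK0 ?A'K0.
have ps : principal v = principal (s^-1%:K * v).
  rewrite -principalM; set P := principal s^-1%:K.
  have -> : P = OK; last by rewrite mul1Ideal //;
    apply: (fracIdeal_principal_neq0 denK).
  apply/seteqP; split=> [_ [a Oa <-]|a Oa]; first by apply: integersM => //; apply/intS.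
  by exists (a * s%:K); [apply: integersM => //; apply/intS | field].
apply/(rayPrincipalP invK denK NK_neq0); exists ((x * A)%:K + y * N%:R), (x * A)%:K.
split=> //.
  apply: congOneD => //; last by rewrite vE !mulf_neq0 // fmorph_eq0 invr_eq0.
  apply: integersM; first by apply/intS/integersM.
  apply: integersD; last by apply/intS/integersM.
  apply: integersM; first exact/intS.
  by apply: integersB; [exact: (integers_w integersK minPoly_w) | exact/intS].
by rewrite vE ps mulrAC mulfV // mul1r.
Qed.

(** * Forms with the same ray class are equivalent *)

Lemma rootOf_indep Q p q p' q' : fa Q != 0 ->
  p%:K * rootOf Q + q%:K = p'%:K * rootOf Q + q'%:K -> p = p' /\ q = q'.
Proof.
move=> A0; have AV0 : (fa Q)^-1 != 0 by rewrite invr_eq0.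
have E r s : r%:K * rootOf Q + s%:K =
    (r / fa Q)%:K * w + (s - r * (formShift Q / fa Q))%:K.
  by rewrite rootOf_coord //; ring.
by rewrite !E => /coordI[/(mulIf AV0) -> /addIr].
Qed.

Lemma rootOf_inj Q Q' : fa Q != 0 -> fa Q' != 0 -> discForm Q = d ->
  discForm Q' = d -> rootOf Q = rootOf Q' -> Q = Q'.
Proof.
move=> A0 A'0 dQ dQ'; rewrite !rootOf_coord // => /coordI[/invr_inj eA].
rewrite eA => /(mulIf (invr_neq0 A'0))/oppr_inj eT.
have eB : fb Q = fb Q' by rewrite !fb_shift eT.
have eC : fc Q = fc Q' by apply: (mulIf A'0); rewrite -fc_shift // -eT -eA fc_shift.
by case: Q Q' eA eB eC {dQ dQ' eT A0 A'0} => ? ? ? [? ? ?] /= -> -> ->.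
Qed.

(** The matrix expresses the basis nu z, nu in the basis z', 1, where z and z' are the roots of [Q]
    and [Q']. In particular nu = c_3 z' + c_4, and the congruence on nu becomes one on the second
    row. *)
Lemma rayClass_form_inj Q Q' : forms iota N d Q -> forms iota N d Q' ->
  rayClass N (lattice (rootOf Q) 1) = rayClass N (lattice (rootOf Q') 1) ->
  exists2 g, Gamma1 iota N g & Q' = actForm Q g.
Proof.
move=> fQ fQ'; have [f f'] := (fracIdeal_form fQ, fracIdeal_form fQ').
move=> /(rayClassP invK denK NK_neq0 f f')[_ /(rayPrincipalP invK denK NK_neq0)[al
  [be [ca cb ->]]]].
set nu := al / be => latE.
have [pA dQ OA Ot _] := formsP fQ; have [pA' dQ' OA' Ot' [x [y [Ox Oy xy]]]] :=
  formsP fQ'.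
have A0 := posP pA; have A'0 := posP pA'; have AK0 : (fa Q')%:K != 0 by rewrite
  fmorph_eq0.
have [[Oal al0 [al1 Oal1 al1e]] [Obe be0 [be1 Obe1 be1e]]] := (ca, cb).
have nu0 : nu != 0 by rewrite mulf_neq0 ?invr_eq0.
have {}latE : lattice (rootOf Q') 1 = lattice (nu * rootOf Q) nu.
  by rewrite latE mulIdealC mem_mul_principal // -lattice_scale mulr1.
have := mem_lattice_l (nu * rootOf Q) nu; rewrite -latE => /latticeP[c1 [c2 [O1 O2
  e1]]].
have := mem_lattice_r (nu * rootOf Q) nu; rewrite -latE => /latticeP[c3 [c4 [O3 O4
  e2]]].
have := mem_lattice_l (rootOf Q') 1; rewrite latE => /latticeP[h1 [h2 [Oh1 Oh2 e3]]].
have := mem_lattice_r (rootOf Q') 1; rewrite latE => /latticeP[h3 [h4 [Oh3 Oh4 e4]]].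
rewrite !mulr1 in e1 e2.
have comb p q : p%:K * (nu * rootOf Q) + q%:K * nu =
    (p * c1 + q * c3)%:K * rootOf Q' + (p * c2 + q * c4)%:K.
  by rewrite e1 [X in q%:K * X]e2; ring.
have [e11 e12] : 1 = h1 * c1 + h2 * c3 /\ 0 = h1 * c2 + h2 * c4.
  by apply: (rootOf_indep A'0); rewrite -comb -e3; ring.
have [e21 e22] : 0 = h3 * c1 + h4 * c3 /\ 1 = h3 * c2 + h4 * c4.
  by apply: (rootOf_indep A'0); rewrite -comb -e4; ring.
pose D := c1 * c4 - c2 * c3.
have OD : O D by apply: integersB; apply: integersM.
(* [h1], ..., [h4] describe the inverse change of basis, so the two determinants multiply to 1. *)
have uD : unitO D.
  apply: dvdO1 => //; exists (h1 * h4 - h2 * h3); first by apply: integersB;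
    apply: integersM.
  transitivity ((h1 * c1 + h2 * c3) * (h3 * c2 + h4 * c4)
    - (h1 * c2 + h2 * c4) * (h3 * c1 + h4 * c3)); last by rewrite /D; ring.
  by rewrite -e11 -e12 -e22 mulr1 mul0r subr0.
have [D0 _ _] := uD.
pose g : 'M[F]_2 := \matrix_(i, j) if i == 0 then (if j == 0 then c1 else c2)
  else (if j == 0 then c3 else c4).
have g00 : g 0 0 = c1 by rewrite mxE.
have g01 : g 0 1 = c2 by rewrite mxE.
have g10 : g 1 0 = c3 by rewrite mxE.
have g11 : g 1 1 = c4 by rewrite mxE.
have gD : \det g = D by rewrite det_mx2 g00 g01 g10 g11.
have g0 : \det g != 0 by rewrite gD.
(* The positive [w]-coordinate of the root of [Q] is [D * n] with [n] positive. *)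
have pD : positive iota D.
  have [n [r [pn _]]] := rootOf_moebius pA' dQ' g0.
  rewrite g00 g01 g10 g11 -e1 -e2 mulrAC mulfV // mul1r rootOf_coord // gD.
  by move=> /coordI[eD _]; apply: (positiveMr pn); rewrite mulrC -eD; apply: positiveV.
pose m := c3%:K * (w - (formShift Q')%:K) + (fa Q' * c4)%:K.
have OKm : OK m.
  apply: integersD; last by apply/intS/integersM.
  apply: integersM; first exact/intS.
  by apply: integersB; [exact: (integers_w integersK minPoly_w) | exact/intS].
have eal : (fa Q')%:K * al = be * m.
  have -> : al = be * nu by rewrite /nu mulrC divfK.
  by rewrite e2 /m; field.
(* As a' al = be m and al = be = 1 (mod [N]), the integer [m] = a' nu is congruent to a' = [fa Q'];
   this is the quotient of m - a' by [N]. *)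
have [p [q ge]] := coordX ((fa Q')%:K * al1 - be1 * m).
have [Op Oq] : O p /\ O q.
  by apply/intC; rewrite -ge; apply: integersB; apply: integersM => //; apply/intS.
have [c3E c4E] : c3 = p * N%:R /\ fa Q' * (c4 - 1) - c3 * formShift Q' = q * N%:R.
  have NE : N%:R = N%:R%:K :> K by rewrite rmorph_nat.
  apply: coordI; transitivity (m - (fa Q')%:K); first by rewrite /m; ring.
  transitivity ((p%:K * w + q%:K) * N%:R); last by rewrite NE; ring.
  rewrite -ge; transitivity ((fa Q')%:K * (al1 * N%:R) - be1 * N%:R * m); last by ring.
  by rewrite -al1e -be1e mulrBr eal; ring.
have Gg : Gamma1 iota N g.
  split; rewrite ?gD //.
  - by split=> // i j; rewrite mxE; do 2!case: ifP.
  - by rewrite g10; exists p.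
  - exists 1; first exact: unitO1.
    (* The congruence gives a' (c_4 - 1) = 0 (mod [N]), and x a' + y N = 1 inverts a'. *)
    rewrite g11; exists (x * (q + p * formShift Q') + y * (c4 - 1)).
      have ON := @integers1 F.
      by apply: integersD; apply: integersM => //; [apply: integersD => //;
        apply: integersM | apply: integersB].
    transitivity ((x * fa Q' + y * N%:R) * (c4 - 1)); first by rewrite xy mul1r.
    transitivity (x * (fa Q' * (c4 - 1) - c3 * formShift Q') + x * c3 * formShift Q'
      + y * N%:R * (c4 - 1)); first by ring.
    by rewrite c4E {1}c3E; ring.
(* With discriminant [d] and positive leading coefficient a form is determined by its root, so it
   suffices that the root of [Q'] is one of [actForm Q g]. *)
exists g => //; have dQg : discForm (actForm Q g) = d by rewrite discForm_act.
have pAg : positive iota (fa (actForm Q g)).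
  rewrite /actForm; cbn [fa]; apply: positiveM; first by rewrite gD; apply: positiveV.
  rewrite g00 g10; apply: positive_evalForm => //; rewrite -negb_and.
  apply: contra D0 => /andP[/eqP c10 /eqP c30].
  by rewrite /D c10 c30 mul0r mulr0 subrr.
apply: rootOf_inj => //; first exact: posP.
apply: rootOf_unique => //; first exact: rootOf_upper.
have gK0 : (\det g)%:K != 0 by rewrite fmorph_eq0.
apply: (mulfI gK0); rewrite mulr0.
rewrite -(@root_actForm Q g (nu * rootOf Q) nu) // ?g00 ?g01 ?g10 ?g11 //.
rewrite -[RHS](mulr0 (nu ^+ 2)) -(rootOf_root A0 dQ); ring.
Qed.

(** * Every ray class comes from a form *)

Lemma latticeN (z1 z2 : K) : lattice (- z1) z2 = lattice z1 z2.
Proof.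
have sub (z z' : K) : lattice (- z) z' `<=` lattice z z'.
  move=> _ /latticeP[x [y [Ox Oy ->]]]; apply/latticeP; exists (- x), y.
  by split; [exact: integersN | | ring].
by apply/seteqP; split; [exact: sub | rewrite -{1}[z1]opprK; apply: sub].
Qed.

(** Since w and w z belong to the lattice, w = p z + q and [p] divides the norm of w - q. The form
    has leading coefficient [p] and shift [q]. *)
Lemma form_of_lattice z : fracIdeal (lattice z 1) -> exists Q,
  [/\ (O (fa Q) /\ O (fb Q)) /\ O (fc Q), gcd_one [:: fa Q; fb Q; fc Q],
      positive iota (fa Q), discForm Q = d & lattice (rootOf Q) 1 = lattice z 1].
Proof.
move=> fz; have OKw := integers_w integersK minPoly_w.
have := fracIdealM fz OKw (mem_lattice_r z 1).
rewrite mulr1 => /latticeP[p [q [Op Oq]]]; rewrite mulr1 => we.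
have p0 : p != 0.
  apply: contra_eq_neq we => ->; rewrite rmorph0 mul0r add0r; apply/eqP => we.
  have [] : (1 : F) = 0 /\ 0 = q by apply: coordI; rewrite rmorph1 rmorph0 we; ring.
  by move/eqP; rewrite oner_eq0.
(* Replacing [z] by its opposite keeps the lattice and changes the sign of [p]. *)
wlog pp : z p fz Op we p0 / positive iota p => [wl|].
  have [pp|pp] := positive_or_neg p0; first exact: (wl z p).
  rewrite -(latticeN z); apply: (wl (- z) (- p)) => //.
  - by rewrite latticeN.
  - exact: integersN.
  - by rewrite we; ring.
  - by rewrite oppr_eq0.
have := fracIdealM fz OKw (mem_lattice_l z 1) => /latticeP[r [s [Or Os]]].
have pK0 : p%:K != 0 by rewrite fmorph_eq0.
have zE : z = (w - q%:K) / p%:K by rewrite we; field.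
move=> e; have [re se] : - b - q = r /\ - c = s * p - r * q.
  apply: coordI; transitivity (p%:K * (w * z)); last by rewrite e zE; field.
  transitivity (w ^+ 2 - q%:K * w); last by rewrite zE; field.
  by rewrite w2; ring.
have ne : q ^+ 2 + b * q + c = - s * p.
  by rewrite -[c]opprK se -re; ring.
exists (Form p (b + 2%:R * q) (- s)); cbn [fa fb fc].
have dE : discForm (Form p (b + 2%:R * q) (- s)) = d.
  rewrite /discForm; cbn [fa fb fc].
  transitivity ((b + 2%:R * q) ^+ 2 - 4%:R * (- s * p)); first by ring.
  by rewrite -ne; ring.
have OB : O (b + 2%:R * q).
  by apply: integersD => //; apply: integersM => //; apply: integers_nat.
split=> //.
- by do 2?split=> //; apply: integersN.
- by apply: (lattice_primitive integersK minPoly_w Op p0 Oq _ ne); apply: integersN.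
- by rewrite zE; congr (lattice ((w - _%:K) / _) 1); rewrite /formShift; cbn [fb];
  field.
Qed.

(** A primitive vector (u, v) is completed to a basis by (q, - p), a matrix of determinant 1. *)
Lemma lattice_unimodular (u v p q : F) (z1 z2 : K) : O u -> O v -> O p -> O q ->
  p * u + q * v = 1 ->
  lattice (q%:K * z1 + (- p)%:K * z2) (u%:K * z1 + v%:K * z2) = lattice z1 z2.
Proof.
move=> Ou Ov Op Oq e.
pose g : 'M[F]_2 := \matrix_(i, j) if i == 0 then (if j == 0 then q else - p)
  else (if j == 0 then u else v).
have gD : \det g = 1 by rewrite det_mx2 !mxE /= -e; ring.
rewrite -(@lattice_GL2 g z1 z2); first by rewrite !mxE.
  by move=> i j; rewrite mxE; do 2!case: ifP => _ //; apply: integersN.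
by rewrite gD; apply: unitO1.
Qed.

Lemma rayClass_form_surj I : idealsPrimeTo N I ->
  exists2 Q, forms iota N d Q & rayClass N (lattice (rootOf Q) 1) = rayClass N I.
Proof.
move=> pI; have [fI _] := pI.
have /(idealsPrimeToP invK NK_neq0 fI)[al0 [be [ca cb beI Ial]]] := pI.
have [Obe be0 _] := cb; have fbe := fracIdeal_principal_neq0 denK be0.
pose J := mulIdeal I (principal be); have fJ : fracIdeal J by apply: fracIdeal_mul.
have -> : rayClass N I = rayClass N J.
  apply/(rayClassP invK denK NK_neq0 fI fJ); exists (principal be) => //.
  apply/(rayPrincipalP invK denK NK_neq0); exists be, 1.
  by rewrite divr1; split=> //; apply: congOne1.
have JE : J = [set be * z | z in I] by rewrite /J mulIdealC mem_mul_principal.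
have JO : J `<=` OK by rewrite JE => _ [z Iz <-]; apply: beI.
have Jal : J al0 by rewrite JE; exists (al0 / be) => //; rewrite mulrC divfK.
clearbody J; move=> {pI fI cb Ial beI I JE fbe be Obe be0}.
have [_ _ [g0 Og0 ge0]] := ca.
have [k [a [t [k0 [Oa a0] Ot dk]]]] :=
  fracIdeal_lattice pid dimK integersK Ob minPoly_w fJ.
have [fM _] := intIdeal_lattice integersK Ob minPoly_w Oa a0 Ot dk.
rewrite mem_mul_principal // -lattice_scale.
set xi1 := k%:K * _; set xi2 := k%:K * _ => Je.
have J1 : J xi1 by rewrite Je; apply: mem_lattice_l.
have J2 : J xi2 by rewrite Je; apply: mem_lattice_r.
have [x [y0 [Ox Oy0 ale]]] : exists x y, [/\ O x, O y & al0 = x%:K * xi1 + y%:K * xi2].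
  by apply/latticeP; rewrite -Je.
have NE : N%:R = N%:R%:K :> K by rewrite rmorph_nat.
have ONF := @integers_nat F N; have ONK := @integers_nat K N.
have NF0 : N%:R != 0 :> F by exact: natr_neq0_numField.
(* [stable_range] wants a nonzero second coordinate; a zero one is replaced by [N], which keeps the
   congruence. *)
have [y [g [Oy y_neq0 Og ge]]] : exists y g, [/\ O y, y != 0, OK g &
    x%:K * xi1 + y%:K * xi2 - 1 = g * N%:R].
  have [y00|] := eqVneq y0 0; last by exists y0, g0; rewrite -ale.
  exists N%:R, (g0 + xi2); split=> //; first by apply: integersD => //; apply: JO.
  by rewrite mulrDl -ge0 ale y00 rmorph0 rmorph_nat; ring.
have [r Or [p [q [Op Oq pq]]]] : exists2 r, O r & comaximal (x + N%:R * r) y.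
  apply: (stable_range pid) => //.
  (* Comparing coordinates along 1 in x xi1 + y xi2 = 1 + g N gives the required relation between
     [x], [y] and [N]. *)
  have [x1 [x2 x12]] := coordX xi1; have [y1 [y2 y12]] := coordX xi2.
  have [g1 [g2 g12]] := coordX g.
  have /intC[_ Ox2] : OK (x1%:K * w + x2%:K) by rewrite -x12; apply: JO.
  have /intC[_ Oy2] : OK (y1%:K * w + y2%:K) by rewrite -y12; apply: JO.
  have /intC[_ Og2] : OK (g1%:K * w + g2%:K) by rewrite -g12.
  exists x2, y2, (- g2); split=> //; first exact: integersN.
  have [_ e] : x * x1 + y * y1 = g1 * N%:R /\ x * x2 + y * y2 - 1 = g2 * N%:R.
    apply: coordI; transitivity (g * N%:R); last by rewrite g12 NE; ring.
    by rewrite -ge x12 y12; ring.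
  by rewrite mulNr -e; ring.
pose nu := (x + N%:R * r)%:K * xi1 + y%:K * xi2.
pose mu := q%:K * xi1 + (- p)%:K * xi2.
have {}Je : J = lattice mu nu.
  rewrite Je (@lattice_unimodular (x + N%:R * r)) //.
  by apply: integersD => //; apply: integersM.
have OKnu : OK nu by apply: JO; rewrite Je; apply: mem_lattice_r.
have OKw := integers_w integersK minPoly_w.
have nue : nu - 1 = (g + r%:K * xi1) * N%:R.
  by rewrite mulrDl -ge /nu NE; ring.
have nu0 : nu != 0.
  (* Otherwise [J] would have rank one over [O_F], and stability under [w] would put [w] in [F]. *)
  apply/eqP => nu0; have [z Jz z0] : exists2 z, J z & z != 0 by case: fJ.
  have mu0 : mu != 0.
    apply: contra_neq z0 => mu0; move: Jz; rewrite Je mu0 nu0 => /latticeP[? [? [_ _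
      ->]]].
    by rewrite !mulr0 addr0.
  have := fracIdealM fJ OKw (_ : J mu); rewrite Je nu0 => /(_ (mem_lattice_l _ _)).
  move=> /latticeP[s [s' [_ _]]]; rewrite mulr0 addr0 => /(mulIf mu0) we.
  have [/eqP] : (1 : F) = 0 /\ 0 = s by apply: coordI; rewrite rmorph1 rmorph0 we; ring.
  by rewrite oner_eq0.
have OKg : OK (g + r%:K * xi1).
  by apply: integersD => //; apply: integersM; [exact/intS | exact: JO].
have cnu : congOne N nu by split=> //; exists (g + r%:K * xi1).
have Jnu : J = [set nu * z | z in lattice (mu / nu) 1].
  by rewrite Je -lattice_scale mulr1 mulrC divfK.
have fz : fracIdeal (lattice (mu / nu) 1).
  have nuV : nu^-1 != 0 by rewrite invr_eq0.
  have -> : lattice (mu / nu) 1 = mulIdeal (principal nu^-1) J.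
    by rewrite mem_mul_principal // Je -lattice_scale mulVf // [nu^-1 * mu]mulrC.
  by apply: fracIdeal_mul => //; apply: fracIdeal_principal_neq0.
have [Q [[[OA OB] OC] cop pA dQ latE]] := form_of_lattice fz.
rewrite -latE in Jnu fz.
have A0 := posP pA; have AK0 : (fa Q)%:K != 0 by rewrite fmorph_eq0.
have fQ : forms iota N d Q.
  split=> //; apply: comaximal_gcd_one.
  (* For the root z of [Q], nu z is integral and a nu z = nu (w - t), with nu = 1 (mod [N]);
     comparing [w]-coordinates gives a e1 = 1 (mod [N]). *)
  have : J (nu * rootOf Q) by rewrite Jnu; exists (rootOf Q) => //;
    apply: mem_lattice_l.
  move/JO; have [e1 [e2 ee]] := coordX (nu * rootOf Q); rewrite ee => /intC[Oe1 Oe2].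
  have [g1 [g2 g12]] := coordX (g + r%:K * xi1).
  have [Og1 Og2] : O g1 /\ O g2 by apply/intC; rewrite -g12.
  exists e1, (g1 * (b + formShift Q) - g2); split=> //.
    apply: integersB => //; apply: integersM => //; apply: integersD => //.
    exact: formShift_int.
  have [eA _] : fa Q * e1 = 1 + (g2 - g1 * (b + formShift Q)) * N%:R /\
      fa Q * e2 = - (g1 * c * N%:R + (1 + g2 * N%:R) * formShift Q).
    apply: coordI; transitivity ((fa Q)%:K * (e1%:K * w + e2%:K)); first by ring.
    rewrite -ee; transitivity (nu * (w - (formShift Q)%:K)); first by field.
    have -> : nu = 1 + (g1%:K * w + g2%:K) * N%:R by rewrite -g12 -nue; ring.
    rewrite NE; transitivity (g1%:K * N%:R%:K * w ^+ 2
      + (1 + g2%:K * N%:R%:K - g1%:K * N%:R%:K * (formShift Q)%:K) * w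
      - (1 + g2%:K * N%:R%:K) * (formShift Q)%:K); first by ring.
    by rewrite w2; ring.
  by rewrite mulrC eA; ring.
exists Q => //; apply/(rayClassP invK denK NK_neq0 fz fJ); exists (principal nu).
  apply/(rayPrincipalP invK denK NK_neq0); exists nu, 1.
  by rewrite divr1; split=> //; apply: congOne1.
by rewrite mulIdealC mem_mul_principal.
Qed.

End FormClassMap.

(** * Transport of the group structure, and the theorem *)

Lemma isGroupIsoOn_transport (T U : Type) (A : set T) (B : set U)
    (opB : U -> U -> U) (f : T -> U) : set_bij A B f -> isGroupOn B opB ->
  exists opA, isGroupIsoOn A opA B opB f.
Proof.
move=> fbij gB; have [fAB finj fsurj] := fbij; have [clB asB [e [Be eB invB]]] := gB.
(* A preimage of the unit serves as the value of the inverse map outside [B]. *)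
have [x0 Ax0 _] := fsurj _ Be.
have [g gP] : exists g, forall y, B y -> A (g y) /\ f (g y) = y.
  have /choice[g gP] : forall y, exists x, B y -> A x /\ f x = y.
    move=> y; have [/fsurj[x Ax fx]|nB] := pselect (B y); first by exists x.
    by exists x0.
  by exists g.
have gB_A y : B y -> A (g y) by move=> /gP[].
have fg y : B y -> f (g y) = y by move=> /gP[].
have gf x : A x -> g (f x) = x.
  by move=> Ax; apply: finj; rewrite ?inE; [apply/gB_A/fAB | | apply/fg/fAB].
exists (fun x y => g (opB (f x) (f y))); split=> //; last first.
  by move=> x y Ax Ay; apply/fg/clB; apply: fAB.
split.
- by move=> x y Ax Ay; apply/gB_A/clB; apply: fAB.
- move=> x y z /fAB Ax /fAB Ay /fAB Az.
  by rewrite !fg ?asB //; apply: clB.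
- exists (g e); split; first exact: gB_A.
    by move=> x Ax; rewrite fg //; have [-> ->] := eB _ (fAB _ Ax); rewrite gf.
  move=> x Ax; have [y [By yx xy]] := invB _ (fAB _ Ax).
  by exists (g y); rewrite fg // yx xy; split=> //; apply: gB_A.
Qed.

Theorem theorem4p4 (R : realType) (F : fieldExtType rat) (K : fieldExtType F)
    (iota : {rmorphism K -> R[i]})
    (hCM : isCM R K)
    (hF : classNumberOne F)
    (wK : K) (hwK : upperHalf iota wK)
    (hOK : ringOfIntegers K = lattice wK 1)
    (bK cK : F) (hbK : ringOfIntegers F bK) (hcK : ringOfIntegers F cK)
    (hmin : minPoly 1%AS wK =
            map_poly (in_alg K) ('X^2 + bK *: 'X + cK%:P))
    (N : nat) (hN : (0 < N)%N) :
  let dK := bK ^+ 2 - 4%:R * cK in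
  let CF := formClasses iota N dK in
  exists phi : set (bqForm F) -> set (set K),
    [/\ forall Q, forms iota N dK Q ->
          idealsPrimeTo N (lattice (rootForm iota Q) 1) /\
          phi (formClass iota N Q) = rayClass N (lattice (rootForm iota Q) 1),
        set_bij CF (rayClassGroup K N) phi
      & exists op : set (bqForm F) -> set (bqForm F) -> set (bqForm F),
          isGroupIsoOn CF op (rayClassGroup K N) (@mulRayClass K) phi].
Proof.
move=> dK CF; have [realF _ dimK] := hCM.
have real_F x : iota x%:A \is Num.real by apply: (realF (iota \o in_alg K)).
have rootE Q : forms iota N dK Q -> rootForm iota Q =
    (wK - in_alg K (formShift bK Q)) / in_alg K (fa Q).
  by move=> [_ _ pA dQ _]; apply: (rootFormE real_F dimK hwK hmin pA dQ).
pose classOf Q := rayClass N (lattice (rootForm iota Q) 1).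
(* One direction makes the map on classes well defined, the other makes it injective. *)
have classOf_eq Q Q' : forms iota N dK Q -> forms iota N dK Q' ->
    formClass iota N Q = formClass iota N Q' <-> classOf Q = classOf Q'.
  move=> fQ fQ'; rewrite /classOf !rootE //; split=> [e|].
    have [g Gg gQ] : formClass iota N Q Q' by rewrite e; apply: formClass_refl.
    by move: fQ'; rewrite -gQ => fQ'; apply: (rayClass_form_act hF real_F dimK hwK
      hOK hbK hmin).
  by move=> /(rayClass_form_inj hF real_F dimK hwK hOK hbK hmin hN fQ fQ')[g Gg ->];
     rewrite formClass_act.
(* The value at a class is read off a chosen representative in [forms]; [set0] is a default outside
   the classes. *)
pose phi C := if pselect (exists Q, forms iota N dK Q /\ formClass iota N Q = C) is
  left h
  then classOf (projT1 (cid h)) else set0.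
have phiE Q : forms iota N dK Q -> phi (formClass iota N Q) = classOf Q.
  move=> fQ; rewrite /phi; case: pselect => [h|[]]; last by exists Q.
  by have [fQ' e] := projT2 (cid h); apply/classOf_eq.
have primeTo Q : forms iota N dK Q -> idealsPrimeTo N (lattice (rootForm iota Q) 1).
  by move=> fQ; rewrite rootE //; apply: (form_idealsPrimeTo hF dimK hOK hbK hmin hN
    fQ).
have bij : set_bij CF (rayClassGroup K N) phi.
  split.
  - move=> _ [Q fQ <-]; rewrite phiE //.
    by exists (lattice (rootForm iota Q) 1) => //; apply: primeTo.
  - move=> _ _ /set_mem[Q fQ <-] /set_mem[Q' fQ' <-]; rewrite !phiE //.
    by move/classOf_eq; apply.
  - move=> _ [I pI <-].
    have [Q fQ e] := rayClass_form_surj hF real_F dimK hOK hbK hmin hN pI.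
    by exists (formClass iota N Q); [exists Q | rewrite phiE // /classOf rootE].
exists phi; split=> // [Q fQ|]; first by split; [apply: primeTo | rewrite phiE].
apply: isGroupIsoOn_transport => //; apply: rayClassGroup_isGroup.
- exact: (invertibleIdeals_K hF dimK hOK hbK hmin).
- exact: (denominators_K dimK hOK hmin).
- by rewrite -[N%:R](rmorph_nat (in_alg K)) fmorph_eq0 natr_neq0_numField.
Qed.
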